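(* Fix $T>0$. For any $\beta_1,\beta_2,\alpha_1,\alpha_2,\sigma>0$ and any $j=1,\dots,N$, with the processes $m_j^N$ and $\tilde m_j$ defined in the context, $$\lim_{N\to\infty}\mathbb{E}\Big[\sup_{t\in[0,T]}\big|m_j^N(t)-\tilde m_j(t)\big|\Big]=0.$$
   Context: Two-level hierarchical model, time scale of order $1$. For each $N$ consider processes $(x_j^N(t),m_j^N(t))_{j=1,\dots,N}$ with $x_j^N\in\mathbb{R}$, $m_j^N\in\{-1,-1+\frac2N,\dots,1\}$, and set $X^N=\frac1N\sum_{j}x_j^N$, $M^N=\frac1N\sum_j m_j^N$. The diffusions satisfy $$dx_j^N(t)=-\frac{\alpha_2}{N}\big[x_j^N(t)-X^N(t)\big]dt+\frac{\sigma}{\sqrt N}\,dW_j^N(t),\qquad x_j^N(0)=x_j\sim\mathcal{N}(0,(\sigma^* )^2)\ \text{i.i.d.},$$ with $W_1^N,\dots,W_N^N$ independent standard Brownian motions. Each $m_j^N$ jumps $m_j^N\mapsto m_j^N\pm\frac2N$ at time $t$ with rate $$N\,\frac{1\mp m_j^N(t)}{2}\Big(1\pm\tanh\big[\beta_1(x_j^N(t)+m_j^N(t))+\beta_2(X^N(t)+M^N(t))\big]\Big),$$ the jump mechanisms for different $j$ being driven by independent noises, independent of the Brownian motions. Initially $m_j^N(0)=\frac1N\sum_{i=1}^N\mu_{ij}(0)$ with $\mu_{ij}(0)\in\{-1,1\}$ i.i.d., $P(\mu_{ij}(0)=1)=p\in[0,1]$, independent of the $x_j$'s and of the driving noises. (The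 parameter $\alpha_1$ of the full model does not enter these averaged dynamics.) Here $\sigma^*>0$ is either a constant independent of $N$, or $\sigma^*=1/\sqrt N$ (the value for the original model, in which case $\mu$ below depends on $N$). Let $\mu=\mathcal{N}(0,(\sigma^* )^2)$ and let $m(t)(x)$ be the unique solution, continuous in $x$ and with values in $[-1,1]$, of $$\dot m(t)(x)=2\tanh\big(\beta_1(x+m(t)(x))+\beta_2M(t)\big)-2m(t)(x),\quad m(0)(x)\equiv2p-1,\quad M(t)=\int_{\mathbb{R}}m(t)(x)\,\mu(dx).$$ Set $\tilde m_j(t):=m(t)(x_j)$, where $x_j=x_j^N(0)$. *)

(* Defs.v *)
From HB Require Import structures.
From mathcomp Require Import all_boot all_order all_algebra.
From mathcomp Require Import all_classical all_reals all_analysis.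

Set Implicit Arguments.
Unset Strict Implicit.
Unset Printing Implicit Defensive.

Import Order.TTheory GRing.Theory Num.Theory.
Import numFieldNormedType.Exports.
Local Open Scope classical_set_scope.
Local Open Scope ring_scope.

(* Processes are functions R -> Omega -> R, of which only the restriction to
   times t >= 0 is meaningful. *)

Section defs.
Context {R : realType}.

Definition tanh (u : R) : R :=
  (expR u - expR (- u)) / (expR u + expR (- u)).

Definition cadlag (f : R -> R) : Prop :=
  forall t : R, 0 <= t ->
    (f s @[s --> t^'+] --> f t) /\ (0 < t -> cvg (f s @[s --> t^'-])).

Definition average (N : nat) (a : 'I_N -> R) : R := (\sum_(i < N) a i) / N%:R.

Section probability.
Context d {Omega : measurableType d} (P : probability Omega R).

Definition sigma_rv (X : Omega -> R) : set (set Omega) :=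
  preimage_set_system setT X measurable.

Definition sigma_process (X : R -> Omega -> R) : set (set Omega) :=
  <<s \bigcup_(t in `[0, +oo[) sigma_rv (X t) >>.

Definition independent (I : finType) (F : I -> set (set Omega)) : Prop :=
  forall (J : {set I}) (A : I -> set Omega), (forall i, i \in J -> F i (A i)) ->
    P (\bigcap_(i in [set` J]) A i) = (\prod_(i in J) P (A i))%E.

Definition independent_increments (X : R -> Omega -> R) : Prop :=
  forall (n : nat) (t : nat -> R), t 0%N = 0 ->
    (forall i, t i <= t i.+1) ->
    independent (fun i : 'I_n => sigma_rv (fun w => X (t i.+1) w - X (t i) w)).

Record brownian_motion (W : R -> Omega -> R) : Prop := {
  brownian_measurable : forall t : R, 0 <= t -> measurable_fun setT (W t);
  brownian0 : forall w, W 0 w = 0;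
  brownian_continuous : forall w, {within `[0, +oo[, continuous (W ^~ w)};
  brownian_independent : independent_increments W;
  (* the second parameter of normal_prob is the standard deviation *)
  brownian_normal : forall s t : R, 0 <= s -> s < t -> forall B, measurable B ->
    P ((fun w => W t w - W s w) @^-1` B) = normal_prob 0 (Num.sqrt (t - s)) B
}.

Record poisson_process (Y : R -> Omega -> R) : Prop := {
  poisson_measurable : forall t : R, 0 <= t -> measurable_fun setT (Y t);
  poisson0 : forall w, Y 0 w = 0;
  poisson_nat : forall (t : R) w, 0 <= t -> Y t w \is a Num.nat;
  poisson_nondecreasing : forall w (s t : R), 0 <= s -> s <= t -> Y s w <= Y t w;
  poisson_cadlag : forall w, cadlag (Y ^~ w);
  poisson_independent : independent_increments Y;
  poisson_law : forall (s t : R) (k : nat), 0 <= s -> s < t ->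
    P [set w | Y t w - Y s w = k%:R] = (poisson_pmf (t - s) k)%:E
}.

(* In the two definitions below, the boolean is true for the jump +2/N and
   false for the jump -2/N. *)
Definition jump_sign (up : bool) : R := if up then 1 else -1.

Definition jump_rate (N : nat) (beta1 beta2 : R)
    (x m : 'I_N -> R -> Omega -> R) (up : bool) (j : 'I_N) (t : R) (w : Omega)
    : R :=
  N%:R * ((1 - jump_sign up * m j t w) / 2) *
  (1 + jump_sign up *
    tanh (beta1 * (x j t w + m j t w) +
          beta2 * (average (fun i => x i t w) + average (fun i => m i t w)))).

(* The independent sources of randomness: the x_j(0), the mu_ij(0), the
   Brownian motions W_j, and for each j the Poisson clocks Y_(up, j) of the
   upward and downward jumps of m_j. *)
Definition source (N : nat) : finType :=
  ('I_N + 'I_N * 'I_N + ('I_N + bool * 'I_N))%type.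

Definition source_sigma (N : nat) (x0 : 'I_N -> Omega -> R)
    (mu : 'I_N -> 'I_N -> Omega -> R) (W : 'I_N -> R -> Omega -> R)
    (Y : bool -> 'I_N -> R -> Omega -> R) (k : source N) : set (set Omega) :=
  match k with
  | inl (inl j) => sigma_rv (x0 j)
  | inl (inr (i, j)) => sigma_rv (mu i j)
  | inr (inl j) => sigma_process (W j)
  | inr (inr (up, j)) => sigma_process (Y up j)
  end.

(* The noise in the diffusions is additive, so the stochastic differential
   equation is a pathwise integral equation. The jump dynamics is the random
   time change representation (Kurtz): the number of jumps up (resp. down) of
   m_j in [0, t] is a unit rate Poisson process, private to j and to the
   direction, evaluated at the integral over [0, t] of the jump rate. *)
Record two_level_process (N : nat) (alpha2 sigma beta1 beta2 p sstar : R)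
    (mu : 'I_N -> 'I_N -> Omega -> R) (W : 'I_N -> R -> Omega -> R)
    (Y : bool -> 'I_N -> R -> Omega -> R)
    (x m : 'I_N -> R -> Omega -> R) : Prop := {
  mu_measurable : forall i j, measurable_fun setT (mu i j);
  mu_values : forall i j w, mu i j w = -1 \/ mu i j w = 1;
  mu_law : forall i j, P [set w | mu i j w = 1] = p%:E;
  W_brownian : forall j, brownian_motion (W j);
  Y_poisson : forall up j, poisson_process (Y up j);
  x0_law : forall j B, measurable B -> P (x j 0 @^-1` B) = normal_prob 0 sstar B;
  sources_independent : independent (source_sigma (fun j => x j 0) mu W Y);
  x_measurable : forall j (t : R), 0 <= t -> measurable_fun setT (x j t);
  x_continuous : forall j w, {within `[0, +oo[, continuous (x j ^~ w)};
  x_equation : forall j, {ae P, forall w, forall t : R, 0 <= t ->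
    x j t w = x j 0 w
      - alpha2 / N%:R * \int[lebesgue_measure]_(s in `[0, t])
                          (x j s w - average (fun i => x i s w))
      + sigma / Num.sqrt N%:R * W j t w};
  m_measurable : forall j (t : R), 0 <= t -> measurable_fun setT (m j t);
  m_cadlag : forall j w, cadlag (m j ^~ w);
  m_values : forall j (t : R) w, 0 <= t ->
    exists2 k : nat, (k <= N)%N & m j t w = -1 + 2 * k%:R / N%:R;
  m0 : forall j w, m j 0 w = average (fun i => mu i j w);
  m_equation : forall j, {ae P, forall w, forall t : R, 0 <= t ->
    let clock up := \int[lebesgue_measure]_(s in `[0, t])
                      jump_rate beta1 beta2 x m up j s w in
    m j t w = m j 0 w
      + 2 / N%:R * (Y true j (clock true) w - Y false j (clock false) w)}
}.

End probability.

Record limit_solution (beta1 beta2 p sstar : R) (m : R -> R -> R) : Prop := {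
  limit_continuous_space : forall t : R, 0 <= t -> continuous (m t);
  limit_values : forall t x : R, 0 <= t -> -1 <= m t x <= 1;
  limit0 : forall x, m 0 x = 2 * p - 1;
  limit_continuous_time : forall x, {within `[0, +oo[, continuous (m ^~ x)};
  limit_ode : forall t x : R, 0 < t ->
    is_derive t (1 : R) (m ^~ x)
      (2 * tanh (beta1 * (x + m t x) +
                 beta2 * \int[normal_prob 0 sstar]_y m t y)
       - 2 * m t x)
}.

End defs.

(* Main.v *)
(* Write m_j(t) with Kurtz's time change: m_j is driven by two unit Poisson
   processes run at clocks of order N T, so replacing each Poisson process by its
   compensator costs (2/N) sup_{u <= 2NT} |Y(u) - u|. As Y is monotone, this
   supremum is controlled by the values of Y on a finite grid plus the mesh, and
   each of these has mean deviation of order sqrt N: no maximal inequality is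
   needed. After compensation m_j and its limit solve the same integral equation
   up to: the law of large numbers for m_j(0), for the average of the x_i(0) and
   for the average of the m(t)(x_i(0)) (uniformly in t, by the Lipschitz
   continuity in time and a grid again), and the displacement of the x_i, whose
   noise is of order 1/sqrt N and enters only through time integrals, so that
   Tonelli's theorem suffices. A pathwise contraction argument in the norm
   sup_t e^{-lt} |.| then bounds the error by these terms. With K grid cells the
   mean error is at most C (K / sqrt N + 1 / K); let N, then K, tend to infinity. *)

Require Import Defs.
From HB Require Import structures.
From mathcomp Require Import all_boot all_order all_algebra.
From mathcomp Require Import all_classical all_reals all_analysis.
From mathcomp Require Import measurable_realfun ring lra.

Set Implicit Arguments.
Unset Strict Implicit.
Unset Printing Implicit Defensive.

Import Order.TTheory GRing.Theory Num.Theory.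
Import numFieldNormedType.Exports.
Local Open Scope classical_set_scope.
Local Open Scope ring_scope.

(** * Bounds on means *)

(** The obstacle is that the clock of each Poisson process is random and depends, through the rates,
    on all the noises. Each rate lies in [0, 2N], however, so the clocks stay in the deterministic
    interval [0, 2NT]; a supremum over that interval decouples a Poisson process from its clock, and
    the comparison can be made path by path. Means are taken only of the final bound, a combination
    of explicit measurable terms, since measurability of the supremum over t is not established. The
    spins are coupled only through the average M, so the contraction is run for all of them at once
    and closes on averages. The limit equation has no counterpart of X because the x_i(0) are
    centred: |X| is itself an error term. When the initial deviation is 1/sqrt N, the limit m
    depends on N; the constants therefore see [sstar] only through an upper bound [kappa], and m
    only through |m| <= 1 and the time-Lipschitz constant 4 that follows from it. *)

Section mean_bound.
Context d {Omega : measurableType d} {R : realType} (P : probability Omega R).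
Implicit Types (f g : Omega -> R) (c : R).

(** The bound carries along the side conditions of monotonicity and linearity of the integral, so
    that a bound on means can be assembled term by term along the shape of a pathwise bound. *)
Definition mean_le f c : Prop :=
  [/\ measurable_fun setT f, forall w, 0 <= f w
    & (\int[P]_w (f w)%:E <= c%:E)%E].

Lemma mean_le_dom f g c : measurable_fun setT f ->
  (forall w, 0 <= f w <= g w) -> mean_le g c -> mean_le f c.
Proof.
move=> mf fg [mg g0 gc]; split=> // [w|]; first by case/andP: (fg w).
apply: le_trans gc; apply: ge0_le_integral => //.
- by move=> w _; rewrite lee_fin; case/andP: (fg w).
- exact/measurable_EFinP.
- exact/measurable_EFinP.
- by move=> w _; rewrite lee_fin; case/andP: (fg w).
Qed.

Lemma mean_leW f c c' : c <= c' -> mean_le f c -> mean_le f c'.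
Proof. by move=> cc' [mf f0 fc]; split=> //; apply: le_trans fc _; rewrite lee_fin. Qed.

Lemma mean_le_cst c : 0 <= c -> mean_le (cst c) c.
Proof.
move=> c0; split=> //.
have /= -> := integral_cst P (@measurableT _ Omega) c%:E.
by rewrite probability_setT mule1.
Qed.

Lemma mean_leD f g c c' : mean_le f c -> mean_le g c' ->
  mean_le (fun w => f w + g w) (c + c').
Proof.
move=> [mf f0 fc] [mg g0 gc]; split.
- exact: measurable_funD.
- by move=> w; rewrite addr_ge0.
under eq_integral do rewrite EFinD.
rewrite ge0_integralD//.
- by rewrite EFinD leeD.
- by move=> w _; rewrite lee_fin.
- exact/measurable_EFinP.
- by move=> w _; rewrite lee_fin.
- exact/measurable_EFinP.
Qed.

Lemma mean_leZ f c k : 0 <= k -> mean_le f c -> mean_le (fun w => k * f w) (k * c).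
Proof.
move=> k0 [mf f0 fc]; split.
- exact: measurable_funM.
- by move=> w; rewrite mulr_ge0.
under eq_integral do rewrite EFinM.
rewrite ge0_integralZl_EFin//.
- by rewrite EFinM lee_wpmul2l// lee_fin.
- by move=> w _; rewrite lee_fin.
- exact/measurable_EFinP.
Qed.

Lemma mean_le_sum (I : Type) (s : seq I) (f : I -> Omega -> R) (c : I -> R) :
  (forall i, mean_le (f i) (c i)) ->
  mean_le (fun w => \sum_(i <- s) f i w) (\sum_(i <- s) c i).
Proof.
move=> fc; elim: s => [|i s IH].
  rewrite big_nil (_ : (fun _ => _) = cst 0); first exact: mean_le_cst.
  by apply/funext => w; rewrite big_nil.
rewrite big_cons; under eq_fun do rewrite big_cons.
exact: mean_leD.
Qed.

Lemma mean_le_average (N : nat) (f : 'I_N.+1 -> Omega -> R) c :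
  (forall i, mean_le (f i) c) -> mean_le (fun w => average (f ^~ w)) c.
Proof.
move=> fc; have := @mean_leZ _ _ (N.+1%:R^-1) _ (mean_le_sum (index_enum _) fc).
rewrite invr_ge0 ler0n => /(_ isT).
rewrite sumr_const card_ord -[c *+ _]mulr_natl mulKf//.
by under eq_fun do rewrite mulrC.
Qed.

(* Young's inequality [2 |z| <= e + z^2 / e]; it stands in for Cauchy-Schwarz. *)
Lemma mean_le_sqr f c e : 0 < e -> measurable_fun setT f ->
  mean_le (fun w => f w ^+ 2) c -> mean_le (fun w => `|f w|) ((e + c / e) / 2).
Proof.
move=> e0 mf fc; apply: (@mean_le_dom _ (fun w => 2^-1 * (e + e^-1 * f w ^+ 2))).
- exact: measurableT_comp.
- move=> w; rewrite normr_ge0 /= -(ler_pM2l (_ : 0 < 2 * e)) ?mulr_gt0//.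
  have -> : 2 * e * (2^-1 * (e + e^-1 * f w ^+ 2)) = e ^+ 2 + `|f w| ^+ 2.
    by rewrite real_normK ?num_real//; field; rewrite gt_eqF.
  rewrite -subr_ge0 (_ : _ - _ = (e - `|f w|) ^+ 2) ?sqr_ge0//; ring.
- rewrite [_ / 2]mulrC [c / e]mulrC; apply: mean_leZ => //; apply: mean_leD.
    by apply: mean_le_cst; exact: ltW.
  by apply: mean_leZ => //; rewrite invr_ge0 ltW.
Qed.

Lemma mean_le_integrable f c : mean_le f c -> P.-integrable setT (EFin \o f).
Proof.
move=> [mf f0 fc]; apply/integrableP; split; first exact/measurable_EFinP.
apply: le_lt_trans (ltry c); apply: le_trans fc.
rewrite le_eqVlt; apply/orP; left; apply/eqP/eq_integral => w _.
by rewrite /= ger0_norm.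
Qed.

Lemma sqr_integrable f c : measurable_fun setT f ->
  mean_le (fun w => f w ^+ 2) c -> P.-integrable setT (EFin \o f).
Proof.
move=> mf /(mean_le_sqr ltr01 mf)/mean_le_integrable/integrableP[_ fi].
apply/integrableP; split; first exact/measurable_EFinP.
by apply: le_lt_trans fi; under [X in (_ <= X)%E]eq_integral do rewrite /= normr_id.
Qed.

(* No measurability of [f]: the integral of a nonnegative function is a lower
   integral, hence monotone. *)
Lemma integral_le_mean f g c : mean_le g c -> (forall w, 0 <= f w) ->
  {ae P, forall w, f w <= g w} -> (\int[P]_w (f w)%:E <= c%:E)%E.
Proof.
move=> [mg g0 gc] f0 [A [mA A0 fgA]].
(* The value +oo on the exceptional null set turns the almost sure bound into one valid everywhere,
   without changing the integral. *)
pose h w : \bar R := if w \in A then +oo%E else (g w)%:E.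
have mh : measurable_fun setT h.
  apply: measurable_fun_ifT => //; last exact/measurable_EFinP.
  by apply: (measurable_fun_bool true); rewrite setTI preimage_mem_true.
have h0 w : (0 <= h w)%E by rewrite /h; case: ifP => // _; rewrite lee_fin.
have fh w : ((f w)%:E <= h w)%E.
  rewrite /h; case: ifPn => [_|/negP wA]; first exact: leey.
  by rewrite lee_fin; apply: contrapT => fg; apply: wA; rewrite inE; exact: fgA.
apply: le_trans (_ : (\int[P]_w h w <= _)%E); last first.
  rewrite (_ : (\int[P]_w h w = \int[P]_w (g w)%:E)%E)//.
  apply: ge0_ae_eq_integral => //; first exact/measurable_EFinP.
    by move=> w _; rewrite lee_fin.
  exists A; split=> // w /= hg; apply: contrapT => wA; apply: hg => _.
  by rewrite /h memNset.
rewrite !ge0_integralTE//.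
apply: ge_ereal_sup => _ [k /= kf <-]; apply: ereal_sup_ubound.
by exists k => // w; exact: le_trans (kf w) (fh w).
Qed.

End mean_bound.

(** * Averages of pairwise independent variables *)

Section pair_independence.
Context d {Omega : measurableType d} {R : realType} (P : probability Omega R).
Local Open Scope ereal_scope.

Definition pair_independent (X Y : Omega -> R) : Prop :=
  forall A B, measurable A -> measurable B ->
    P (X @^-1` A `&` Y @^-1` B) = P (X @^-1` A) * P (Y @^-1` B).

Lemma pair_independent_comp (X Y : Omega -> R) (f g : R -> R) :
  measurable_fun setT f -> measurable_fun setT g ->
  pair_independent X Y -> pair_independent (f \o X) (g \o Y).
Proof.
move=> mf mg XY A B mA mB; apply: (XY (f @^-1` A) (g @^-1` B)).
- by rewrite -[X in measurable X]setTI; exact: mf.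
- by rewrite -[X in measurable X]setTI; exact: mg.
Qed.

(** Independence identifies the law of the pair with the product of the two laws. Tonelli applied to
    |x y| then gives integrability of the product, and Fubini factors its mean. *)
Lemma integral_mul_independent (X Y : Omega -> R) :
  P.-integrable setT (EFin \o X) -> P.-integrable setT (EFin \o Y) ->
  pair_independent X Y ->
  P.-integrable setT (EFin \o (fun w => X w * Y w)%R) /\
  \int[P]_w (X w * Y w)%:E = \int[P]_w (X w)%:E * \int[P]_w (Y w)%:E.
Proof.
move=> iX iY XY.
have mX : measurable_fun setT X by apply/measurable_EFinP; exact: measurable_int iX.
have mY : measurable_fun setT Y by apply/measurable_EFinP; exact: measurable_int iY.
pose X' : {RV P >-> R} := HB.pack X (isMeasurableFun.Build _ _ _ _ _ mX).
pose Y' : {RV P >-> R} := HB.pack Y (isMeasurableFun.Build _ _ _ _ _ mY).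
pose Z w := (X w, Y w).
have mZ : measurable_fun setT Z by exact: measurable_fun_pair.
pose Z' : {RV P >-> (R * R)%type} := HB.pack Z (isMeasurableFun.Build _ _ _ _ _ mZ).
pose m1 := distribution P X'; pose m2 := distribution P Y'.
have lawZ A : measurable A -> A `<=` setT -> (m1 \x m2) A = distribution P Z' A.
  by move=> mA _; exact: product_measure_unique.
have mid : measurable_fun [set: R] (EFin \o (@id R)).
  exact/measurable_EFinP/measurable_id.
pose f (z : R * R) : \bar R := (z.1 * z.2)%:E.
have mf : measurable_fun setT f.
  exact/measurable_EFinP/measurable_funM.
have i1 : m1.-integrable setT (EFin \o (@id R)).
  apply/integrableP; split => //.
  rewrite /m1 ge0_integral_distribution//; last exact: measurableT_comp.
  by case/integrableP : iX.
have i2 : m2.-integrable setT (EFin \o (@id R)).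
  apply/integrableP; split => //.
  rewrite /m2 ge0_integral_distribution//; last exact: measurableT_comp.
  by case/integrableP : iY.
have if12 : (m1 \x m2).-integrable setT f.
  apply/(integrable12ltyP _ _ mf).
  under eq_integral.
    move=> x _; under eq_integral do rewrite /f /= normrM EFinM.
    rewrite ge0_integralZl_EFin//; last first.
      by apply/measurable_EFinP; exact: normr_measurable.
    over.
  have fin2 : \int[m2]_y `|y%:E| \is a fin_num :=
    integrable_fin_num measurableT (integrable_abse i2).
  rewrite -(fineK fin2). rewrite ge0_integralZr//.
  - rewrite lte_mul_pinfty//; first exact: integral_ge0.
    + have := integrable_fin_num measurableT (integrable_abse i1); exact.
    + by rewrite ltry.
  - by apply/measurable_EFinP; exact: normr_measurable.
  - by rewrite lee_fin fine_ge0// integral_ge0.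
have iZ : P.-integrable setT (EFin \o (fun w => X w * Y w)%R).
  apply/integrableP; split; first exact/measurable_EFinP/measurable_funM.
  have -> : \int[P]_w `|(EFin \o (fun w => X w * Y w)%R) w| =
      \int[distribution P Z']_z `|f z|.
    by rewrite ge0_integral_distribution//; exact: measurableT_comp.
  rewrite -(eq_measure_integral _ lawZ).
  by case/integrableP : if12.
split => //.
have -> : \int[P]_w (X w * Y w)%:E = \int[distribution P Z']_z f z.
  by rewrite integral_distribution.
rewrite -(eq_measure_integral _ lawZ) -integral12_prod_meas1//.
rewrite /fubini_F /f /=.
under eq_integral.
  move=> x _; under eq_integral do rewrite /= EFinM.
  rewrite integralZl//.
  over.
rewrite -(fineK (integrable_fin_num measurableT i2)) integralZr//.
rewrite (fineK (integrable_fin_num measurableT i2)).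
by rewrite /m1 /m2 !integral_distribution.
Qed.

(** When the square is expanded, the cross terms vanish by independence and centring; N + 1 diagonal
    terms remain, against the factor (N + 1)^-2. *)
Lemma mean_le_average_sqr (N : nat) (Z : 'I_N.+1 -> Omega -> R) (v : R) :
  (forall i, measurable_fun setT (Z i)) ->
  (forall i, \int[P]_w (Z i w)%:E = 0) ->
  (forall i, mean_le P (fun w => Z i w ^+ 2)%R v) ->
  (forall i j, i != j -> pair_independent (Z i) (Z j)) ->
  mean_le P (fun w => average (Z ^~ w) ^+ 2)%R (v / N.+1%:R)%R.
Proof.
move=> mZ EZ vZ indZ.
have iZ i : P.-integrable setT (EFin \o Z i) by exact: sqr_integrable (vZ i).
have mS : measurable_fun setT (fun w => \sum_i Z i w)%R by exact: measurable_sum.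
have iZZ i j : P.-integrable setT (EFin \o (fun w => Z i w * Z j w)%R).
  have [<-|ij] := eqVneq i j; first exact: mean_le_integrable (vZ i).
  by have [] := integral_mul_independent (iZ i) (iZ j) (indZ _ _ ij).
split=> [|w|].
- apply: measurable_funX; under eq_fun do rewrite /average.
  exact: measurable_funM.
- exact: sqr_ge0.
under eq_integral do rewrite /average exprMn expr2 big_distrlr/= mulrC EFinM -sumEFin.
rewrite integralZl//; last first.
  apply: integrable_sum => // i _; under eq_fun do rewrite -sumEFin.
  by apply: integrable_sum => // j _; exact: iZZ.
rewrite integral_sum//; last first.
  move=> i; under eq_fun do rewrite -sumEFin.
  by apply: integrable_sum => // j _; exact: iZZ.
have -> : ((v / N.+1%:R)%:E = (N.+1%:R^-1 ^+ 2)%:E * \sum_(i < N.+1) v%:E).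
  rewrite sumEFin sumr_const card_ord -EFinM -[(v *+ _)%R]mulr_natr.
  by congr EFin; field.
rewrite lee_wpmul2l ?lee_fin ?sqr_ge0//.
apply: lee_sum => i _; under eq_integral do rewrite -sumEFin.
rewrite integral_sum//; last by move=> j; exact: iZZ.
rewrite (bigD1 i)//= big1 ?adde0; first by case: (vZ i).
move=> j; rewrite eq_sym => ij.
have [_ /= ->] := integral_mul_independent (iZ i) (iZ j) (indZ i j ij).
by rewrite EZ mul0e.
Qed.

End pair_independence.

(** * Second moments of the noises *)

Section law.
Context d {Omega : measurableType d} {R : realType} (P : probability Omega R).
Local Open Scope ereal_scope.
Variables (X : Omega -> measurableTypeR R).
Variable nu : {measure set (measurableTypeR R) -> \bar R}.
Hypothesis mX : measurable_fun setT X.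
Hypothesis lawX : forall B, measurable B -> P (X @^-1` B) = nu B.

Lemma ge0_integral_law (f : measurableTypeR R -> \bar R) : measurable_fun setT f ->
  (forall x, 0 <= f x) -> \int[P]_w f (X w) = \int[nu]_x f x.
Proof.
move=> mf f0; have := ge0_integral_pushforward mX P measurableT mf.
rewrite preimage_setT => <- //.
by apply: eq_measure_integral => A mA _; exact: lawX.
Qed.

Lemma integral_law (f : measurableTypeR R -> \bar R) : measurable_fun setT f ->
  P.-integrable setT (f \o X) -> \int[P]_w f (X w) = \int[nu]_x f x.
Proof.
move=> mf fX; rewrite -[LHS]/(\int[P]_w (f \o X) w) integralE [RHS]integralE.
congr (_ - _).
- rewrite -(@ge0_integral_law f^\+)//; last exact: measurable_funepos.
  by under eq_integral do rewrite funepos_comp.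
- rewrite -(@ge0_integral_law f^\-)//; last exact: measurable_funeneg.
  by under eq_integral do rewrite funeneg_comp.
Qed.

End law.

Section normal_law.
Context {R : realType}.
Local Notation mu := (@lebesgue_measure R).
Local Open Scope ereal_scope.

(** The Gaussian density and the Radon-Nikodym derivative have the same integral over every
    measurable set, hence agree almost everywhere; the rest is change of variables. *)
Lemma integral_normal_prob (s : R) (f : R -> \bar R) :
  measurable_fun setT f -> (forall x, 0 <= f x) ->
  \int[normal_prob 0 s]_x f x = \int[mu]_x (f x * (normal_pdf 0 s x)%:E).
Proof.
move=> mf f0.
have dom := normal_prob_dominates 0 s.
rewrite -(Radon_Nikodym_SigmaFinite.change_of_variables dom f0 measurableT mf).
have mpdf : measurable_fun setT (EFin \o normal_pdf 0 s).
  by apply/measurable_EFinP; exact: measurable_normal_pdf.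
have irn := Radon_Nikodym_SigmaFinite.f_integrable dom.
have rn_pdf : ae_eq mu setT
    (Radon_Nikodym_SigmaFinite.f (normal_prob 0 s) mu) (EFin \o normal_pdf 0 s).
  apply: integral_ae_eq => // A _ mA.
  by rewrite -Radon_Nikodym_SigmaFinite.f_integral.
apply: ge0_ae_eq_integral => //.
- by apply: emeasurable_funM => //; exact: measurable_int irn.
- exact: emeasurable_funM.
- by move=> x _; rewrite mule_ge0// Radon_Nikodym_SigmaFinite.f_ge0.
- by move=> x _; rewrite mule_ge0// lee_fin normal_pdf_ge0.
- by apply: filterS rn_pdf => x /= fx xT; rewrite fx.
Qed.

Lemma integral_lebesgueN (f : R -> \bar R) : measurable_fun setT f ->
  (forall x, 0 <= f x) -> \int[mu]_x f x = \int[mu]_x f (- x)%R.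
Proof.
move=> mf f0.
have mN : measurable_fun setT (-%R : measurableTypeR R -> measurableTypeR R).
  exact: oppr_measurable.
have := @ge0_integral_pushforward _ _ (measurableTypeR R) (measurableTypeR R) R
  _ mN lebesgue_measure setT f measurableT mf (fun x _ => f0 x).
rewrite preimage_setT => <-.
by apply: eq_measure_integral => A mA _; exact/esym/lebesgue_measureN.
Qed.

(* From [y <= e^y] with [y = 3 x^2 / (8 s^2)]: widening the Gaussian by a factor
   2 absorbs the factor [x^2]. *)
Lemma sqr_normal_pdf_le (s x : R) : (0 < s)%R ->
  (x ^+ 2 * normal_pdf 0 s x <= 6 * s ^+ 2 * normal_pdf 0 (2 * s) x)%R.
Proof.
move=> s0; rewrite !normal_pdfE ?mulf_neq0 ?gt_eqF//.
rewrite /normal_peak /normal_fun subr0.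
have -> : ((2 * s) ^+ 2 * pi *+ 2 = 2 ^+ 2 * (s ^+ 2 * pi *+ 2) :> R)%R by ring.
rewrite sqrtrM ?exprn_ge0// sqrtr_sqr gtr0_norm//.
set c := (Num.sqrt _)^-1%R.
have c0 : (0 <= c)%R by rewrite invr_ge0 sqrtr_ge0.
pose y : R := (3 / 8 * x ^+ 2 / s ^+ 2)%R.
have -> : (- x ^+ 2 / (s ^+ 2 *+ 2) = - x ^+ 2 / ((2 * s) ^+ 2 *+ 2) - y :> R)%R.
  by rewrite /y; field; rewrite gt_eqF.
rewrite expRD expRN invfM -/c.
set e := expR (- x ^+ 2 / _).
have e0 : (0 <= e)%R by exact: expR_ge0.
have ye : (y / expR y <= 1)%R.
  rewrite ler_pdivrMr ?expR_gt0// mul1r.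
  by apply: le_trans (expR_ge1Dx y); rewrite lerDr.
have -> : (x ^+ 2 = 8 / 3 * s ^+ 2 * y :> R)%R.
  by rewrite /y; field; rewrite gt_eqF.
have -> : (8 / 3 * s ^+ 2 * y * (c * (e / expR y)) =
          (y / expR y) * (8 / 3 * s ^+ 2 * c * e) :> R)%R by ring.
have -> : (6 * s ^+ 2 * (2^-1 * c * e) = 3 * s ^+ 2 * c * e :> R)%R by field.
apply: le_trans (_ : 1 * (8 / 3 * s ^+ 2 * c * e) <= _)%R.
  by rewrite ler_wpM2r// !mulr_ge0// ltW.
rewrite mul1r !ler_wpM2r// ?sqr_ge0//; lra.
Qed.

(** The exact value is s^2. The factor 6 is the price of the pointwise domination by a wider
    Gaussian density, whose mass is 1; only the order in s matters later. *)
Lemma normal_sqr_le (s : R) : (0 < s)%R ->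
  \int[normal_prob 0 s]_x (x ^+ 2)%:E <= (6 * s ^+ 2)%:E.
Proof.
move=> s0; rewrite integral_normal_prob; last 2 first.
- by apply/measurable_EFinP; exact: exprn_measurable.
- by move=> x; rewrite lee_fin sqr_ge0.
have m2 := @measurable_normal_pdf R 0 (2 * s).
apply: (@le_trans _ _ (\int[mu]_x ((6 * s ^+ 2)%:E * (normal_pdf 0 (2 * s) x)%:E))).
  apply: ge0_le_integral => //.
  - by move=> x _; rewrite mule_ge0// lee_fin ?sqr_ge0 ?normal_pdf_ge0.
  - apply: emeasurable_funM; apply/measurable_EFinP; first exact: exprn_measurable.
    exact: measurable_normal_pdf.
  - by apply: emeasurable_funM; apply/measurable_EFinP.
  - by move=> x _; rewrite -!EFinM lee_fin sqr_normal_pdf_le.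
rewrite ge0_integralZl_EFin//.
- by rewrite integral_normal_pdf ?mule1// mulf_neq0 ?gt_eqF.
- by move=> x _; rewrite lee_fin normal_pdf_ge0.
- exact/measurable_EFinP.
- by rewrite mulr_ge0// sqr_ge0.
Qed.

Lemma normal_symmetric (s : R) (f : R -> \bar R) : (0 < s)%R ->
  measurable_fun setT f -> (forall x, 0 <= f x) ->
  \int[normal_prob 0 s]_x f (- x)%R = \int[normal_prob 0 s]_x f x.
Proof.
move=> s0 mf f0; have s1 : (s != 0)%R by rewrite gt_eqF.
have mN : measurable_fun setT (-%R : R -> R) by exact: oppr_measurable.
have mp := @measurable_normal_pdf R 0 s.
rewrite !integral_normal_prob//; last exact: measurableT_comp.
rewrite [RHS]integral_lebesgueN.
- apply: eq_integral => x _; rewrite !normal_pdfE// /normal_fun.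
  by rewrite !subr0 sqrrN.
- by apply: emeasurable_funM => //; exact/measurable_EFinP.
- by move=> x; rewrite mule_ge0// lee_fin normal_pdf_ge0.
Qed.

Context d {Omega : measurableType d} (P : probability Omega R) (X : Omega -> R) (s : R).
Hypotheses (s0 : (0 < s)%R) (mX : measurable_fun setT X).
Hypothesis lawX : forall B, measurable B -> P (X @^-1` B) = normal_prob 0 s B.

Lemma normal_mean_sqr : mean_le P (fun w => X w ^+ 2)%R (6 * s ^+ 2)%R.
Proof.
split=> [|w|]; [exact: measurable_funX|exact: sqr_ge0|].
rewrite (ge0_integral_law (nu := normal_prob 0 s) mX lawX (f := fun x => (x ^+ 2)%:E)).
- exact: normal_sqr_le.
- by apply/measurable_EFinP; exact: exprn_measurable.
- by move=> x; rewrite lee_fin sqr_ge0.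
Qed.

(** By symmetry the positive and negative parts have the same integral. The second moment makes it
    finite, so that the difference is really 0 and not oo - oo. *)
Lemma normal_mean : \int[P]_w (X w)%:E = 0.
Proof.
have iX := sqr_integrable mX normal_mean_sqr.
have mid : measurable_fun [set: R] (EFin \o (@id R)) by exact/measurable_EFinP.
rewrite (integral_law (nu := normal_prob 0 s) mX lawX (f := EFin))// integralE.
have -> : (EFin^\- = (fun x => EFin^\+ (- x)%R) :> (R -> \bar R)).
  by apply/funext => x; rewrite funenegE funeposE EFinN.
rewrite normal_symmetric//; last exact: measurable_funepos.
apply: subee; rewrite -(ge0_integral_law (nu := normal_prob 0 s) mX lawX)//; last first.
  exact: measurable_funepos.
have := integrable_fin_num measurableT (integrable_funepos measurableT iX).
by rewrite funepos_comp.
Qed.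

End normal_law.

Section poisson_moment.
Context {R : realType}.

(** From (k - u)^2 = k (k - 1) + (1 - 2u) k + u^2 and k e_k = u e_(k-1), where e_k = u^k / k!. Each
    factor of k shifts the index by one, whence the lengths n, n + 1 and n + 2. Being an exact
    identity of partial sums, it reduces convergence to that of the exponential series. *)
Lemma poisson_sqr_series (u : R) (n : nat) :
  series (fun k => (k%:R - u) ^+ 2 * exp_coeff u k) n.+2 =
  u ^+ 2 * series (exp_coeff u) n + (1 - 2 * u) * u * series (exp_coeff u) n.+1
  + u ^+ 2 * series (exp_coeff u) n.+2.
Proof.
have coefS k : k.+1%:R * exp_coeff u k.+1 = u * exp_coeff u k.
  rewrite /exp_coeff /= factS natrM exprS; field.
  by rewrite nat1r !pnatr_eq0 -lt0n fact_gt0.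
elim: n => [|n IH].
  rewrite /series /= !big_nat_recr//= !big_geq// /exp_coeff /=.
  by field; rewrite !pnatr_eq0.
have sS (f : nat -> R) k : series f k.+1 = series f k + f k.
  by rewrite /series /= big_nat_recr.
rewrite sS IH !(sS (exp_coeff u)).
move: (coefS n) (coefS n.+1) (series _ n) => + + s.
move: (exp_coeff u n) (exp_coeff u n.+1) (exp_coeff u n.+2) => a b c e1 e2.
have e3 : n.+1%:R * n.+2%:R * c = u ^+ 2 * a :> R.
  by rewrite -mulrA e2 mulrCA e1; ring.
have -> : (n.+2%:R - u) ^+ 2 * c =
  n.+1%:R * n.+2%:R * c + (1 - 2 * u) * (n.+2%:R * c) + u ^+ 2 * c.
  rewrite -[n.+2]addn1 -[n.+1]addn1 !natrD; ring.
rewrite e3 e2; ring.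
Qed.

Lemma cvg_poisson_sqr (u : R) :
  series (fun k => (k%:R - u) ^+ 2 * exp_coeff u k) @ \oo --> u * expR u.
Proof.
rewrite -cvg_shiftS -cvg_shiftS /=.
have cE : series (exp_coeff u) @ \oo --> expR u by exact: is_cvg_series_exp_coeff.
have -> : u * expR u = u ^+ 2 * expR u + (1 - 2 * u) * u * expR u + u ^+ 2 * expR u.
  by ring.
rewrite (_ : (fun _ => _) = fun n => u ^+ 2 * series (exp_coeff u) n
    + (1 - 2 * u) * u * series (exp_coeff u) n.+1
    + u ^+ 2 * series (exp_coeff u) n.+2); last first.
  by apply/funext => n; exact: poisson_sqr_series.
have cE1 : series (exp_coeff u) n.+1 @[n --> \oo] --> expR u.
  by rewrite (cvg_shiftS (series (exp_coeff u))).
have cE2 : series (exp_coeff u) n.+2 @[n --> \oo] --> expR u.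
  by rewrite (cvg_shiftS (fun n => series (exp_coeff u) n.+1)).
by apply: cvgD; [apply: cvgD|]; apply: cvgM => //; exact: cvg_cst.
Qed.

Context d {Omega : measurableType d} (P : probability Omega R).
Variable Y : R -> Omega -> R.
Hypothesis HY : poisson_process P Y.

(** The space is partitioned by the integer value of [Y u]; the mean becomes e^(-u) times the series
    above, which is the Poisson variance u. *)
Lemma poisson_mean_sqr (u : R) : 0 < u ->
  mean_le P (fun w => (Y u w - u) ^+ 2) u.
Proof.
move=> u0; have mY := poisson_measurable HY (ltW u0).
have mf : measurable_fun setT (fun w => (Y u w - u) ^+ 2).
  by apply: measurable_funX; exact: measurable_funB.
split=> // [w|]; first exact: sqr_ge0.
pose F (k : nat) := [set w | Y u w = k%:R].
have mF k : measurable (F k).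
  by rewrite -[F k]setTI; exact: (mY measurableT [set k%:R]).
have UF : setT = \bigcup_k F k.
  apply/seteqP; split => // w _.
  by have /natrP[k Yk] := poisson_nat HY w (ltW u0); exists k.
have tF : trivIset setT F.
  apply/trivIsetP => i j _ _ ij; apply/seteqP.
  split => // w []; rewrite /F /= => -> /eqP.
  by rewrite eqr_nat (negbTE ij).
rewrite UF ge0_integral_bigcup//; last 2 first.
- by apply/measurable_EFinP; rewrite -UF.
- by move=> w _; rewrite lee_fin sqr_ge0.
have PF k : (P (F k) = (poisson_pmf u k)%:E)%E.
  rewrite -[u in RHS]subr0 -(poisson_law HY)//.
  by congr (P _); apply/seteqP; split => w /=; rewrite (poisson0 HY) subr0.
have -> : (\sum_(k <oo) \int[P]_(w in F k) ((Y u w - u) ^+ 2)%:E =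
    \sum_(k <oo) (expR (- u) * ((k%:R - u) ^+ 2 * exp_coeff u k))%:E)%E.
  apply: eq_eseriesr => k _.
  rewrite (eq_integral (cst ((k%:R - u) ^+ 2)%:E)); last first.
    by move=> w; rewrite inE => /= ->.
  rewrite integral_cst// [X in (_ * X)%E](PF k) /poisson_pmf u0 -EFinM; congr EFin.
  by rewrite /exp_coeff /=; ring.
rewrite le_eqVlt; apply/orP; left; apply/eqP/cvg_lim => //.
rewrite (_ : (fun _ => _) = EFin \o (fun n => expR (- u) *
    series (fun k => (k%:R - u) ^+ 2 * exp_coeff u k) n)); last first.
  by apply/funext => n; rewrite /= /series /= mulr_sumr -sumEFin.
apply: cvg_EFin; first exact: nearW.
rewrite -[X in _ --> X](_ : expR (- u) * (u * expR u) = u); last first.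
  by rewrite mulrCA -expRD addNr expR0 mulr1.
by apply: cvgM; [exact: cvg_cst|exact: cvg_poisson_sqr].
Qed.

End poisson_moment.

(** * Integrated right-continuous processes *)

Section right_continuous_process.
Context d {Omega : measurableType d} {R : realType}.
Local Notation mu := (@lebesgue_measure R).
Variable X : R -> Omega -> R.
Hypothesis mX : forall t : R, 0 <= t -> measurable_fun setT (X t).
Hypothesis rcX : forall (t : R) w, 0 <= t -> X s w @[s --> t^'+] --> X t w.

(* The process is the limit of its values at the next point of the grid of mesh
   [1 / n.+1]. *)
Lemma measurable_right_continuous_process :
  measurable_fun setT (fun z : R * Omega => X (Num.max 0 z.1) z.2).
Proof.
pose tr n (z : R * Omega) := Num.trunc (Num.max 0 z.1 * n.+1%:R).
have m0 n : measurable_fun setT (fun z : R * Omega => Num.max 0 z.1 * n.+1%:R).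
  by apply: measurable_funM => //; exact: measurable_maxr.
apply: (@measurable_fun_cvg _ _ _ _
  (fun n z => X ((tr n z).+1%:R / n.+1%:R) z.2)) => [n|[t w] _ /=].
(* Where the grid index equals k, the approximation is [X] at a deterministic time, hence
   measurable. *)
- have -> : setT = \bigcup_k [set z | tr n z = k].
    by apply/seteqP; split => // z _; exists (tr n z).
  have trE k : [set z | tr n z = k] =
      (fun z : R * Omega => Num.max 0 z.1 * n.+1%:R) @^-1` `[k%:R, k.+1%:R[.
    apply/seteqP; split => z /=; rewrite /tr in_itv/=.
      by move/eqP; rewrite truncn_eq// mulr_ge0// le_max lexx.
    by rewrite -truncn_eq ?mulr_ge0 ?le_max ?lexx// => /eqP.
  have mtr k : measurable [set z | tr n z = k].
    by rewrite trE -[X in measurable X]setTI; exact: m0.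
  apply/measurable_fun_bigcup => // k.
  apply: (@eq_measurable_fun _ _ _ _ _ (fun z => X (k.+1%:R / n.+1%:R) z.2)).
    by move=> z; rewrite inE => /= ->.
  by apply: measurable_funTS; apply: measurableT_comp => //; exact: mX.
- have t0 : 0 <= Num.max 0 t by rewrite le_max lexx.
  move ts : (Num.max 0 t) t0 => s s0.
  have /cvg_at_rightP := @rcX s w s0; apply.
  have sN n : 0 <= s * n.+1%:R by rewrite mulr_ge0.
  split=> [n|].
    (* The successor index puts the grid point strictly to the right of s, even if s is on the grid,
       as the right limit requires. *)
    rewrite ltr_pdivlMr// /tr /= ts; by case/andP: (truncn_itv (sN n)).
  apply: (@squeeze_cvgr _ _ _ _ (cst s) (fun n => s + harmonic n)).
  + apply: nearW => n; rewrite /tr /= ts /harmonic/=.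
    have /andP[h1 h2] := truncn_itv (sN n).
    rewrite ler_pdivlMr// ltW//= ler_pdivrMr// mulrDl mulVf// -natr1.
    by rewrite lerD2r.
  + exact: cvg_cst.
  + rewrite -[X in _ --> X]addr0; apply: cvgD; first exact: cvg_cst.
    exact: cvg_harmonic.
Qed.

(** Tonelli's theorem for the jointly measurable process, cut off by the indicator of [0, T];
    [Num.max 0] only extends it to negative times. *)
Lemma mean_le_Rintegral (P : probability Omega R) (T c : R) : 0 <= T -> 0 <= c ->
  (forall t, 0 <= t <= T -> mean_le P (fun w => `|X t w|) c) ->
  mean_le P (fun w => \int[mu]_(s in `[0, T]) `|X s w|) (T * c).
Proof.
move=> T0 c0 Xc.
pose f (z : measurableTypeR R * Omega) : \bar R :=
  (`|X (Num.max 0 z.1) z.2| * \1_`[0, T] z.1)%:E.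
have mf : measurable_fun setT f.
  apply/measurable_EFinP; apply: measurable_funM.
    by apply: measurableT_comp => //; exact: measurable_right_continuous_process.
  by apply: measurableT_comp => //; exact: measurable_indic.
have f0 z : (0 <= f z)%E by rewrite lee_fin mulr_ge0// indicE.
have intE w : (\int[mu]_(s in `[0%R, T]) `|X s w|%:E = \int[mu]_s f (s, w))%E.
  rewrite integral_mkcond; apply: eq_integral => s _.
  rewrite patchE /f /= indicE; case: ifPn => sT; last by rewrite mulr0.
  by move: sT; rewrite inE/= in_itv/= => /andP[s0 _]; rewrite max_r// mulr1.
have mint : measurable_fun setT (fun w => \int[mu]_s f (s, w))%E.
  exact: (measurable_fun_fubini_tonelli_G (m1 := mu)).
split=> [|w|].
- rewrite /Rintegral; under eq_fun do rewrite intE.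
  exact: measurableT_comp.
- by apply: Rintegral_ge0.
apply: (@le_trans _ _ (\int[P]_w \int[mu]_s f (s, w))%E).
  apply: ge0_le_integral => //.
  - by move=> w _; rewrite lee_fin Rintegral_ge0.
  - apply/measurable_EFinP; rewrite /Rintegral; under eq_fun do rewrite intE.
    exact: measurableT_comp.
  (* [fine] sends +oo to 0, so the real integral is at most the extended one even if the latter is
     infinite. *)
  - move=> w _; rewrite /Rintegral intE.
    have : (0 <= \int[mu]_s f (s, w))%E by exact: integral_ge0.
    by case: (\int[mu]_s f (s, w))%E => //= *; rewrite leey.
rewrite -(fubini_tonelli (m1 := mu) (m2 := P))//.
apply: (@le_trans _ _ (\int[mu]_s (c * \1_`[0%R, T] s)%:E)%E).
  apply: ge0_le_integral => //.
  - by move=> s _; exact: integral_ge0.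
  - exact: (measurable_fun_fubini_tonelli_F (m2 := P)).
  - by apply/measurable_EFinP; apply: measurable_funM => //; exact: measurable_indic.
  - move=> s _; rewrite /f /= indicE; have [|_] := boolP (s \in _); last first.
      under eq_integral do rewrite mulr0.
      by rewrite integral0 mulr0.
    rewrite inE/= in_itv/= => sT; under eq_integral do rewrite mulr1.
    rewrite mulr1 max_r; last by case/andP: sT.
    by case: (Xc _ sT).
under eq_integral do rewrite EFinM.
rewrite ge0_integralZl_EFin//; last exact/measurable_EFinP/measurable_indic.
rewrite integral_indic// setIT.
have := lebesgue_measure_itv `[0%R, T]; rewrite /= lte_fin => ->.
case: ltgtP T0 => // [T0 _|<- _].
  by rewrite oppr0 adde0 -EFinM mulrC.
by rewrite mule0 mul0r.
Qed.

End right_continuous_process.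

(** * The hyperbolic tangent and grids *)

Section tanh_theory.
Context {R : realType}.
Implicit Types u v : R.

Let den_gt0 u : 0 < expR u + expR (- u).
Proof. by rewrite addr_gt0 ?expR_gt0. Qed.

Lemma normr_tanh_le1 u : `|tanh u| <= 1.
Proof.
rewrite /tanh ler_norml ler_pdivlMr// ler_pdivrMr//.
have := expR_gt0 u; have := expR_gt0 (- u); lra.
Qed.

Lemma is_derive_tanh u : is_derive u 1 tanh (1 - tanh u ^+ 2).
Proof.
have dN : is_derive u 1 (fun x => expR (- x)) (- expR (- u)).
  have := @is_derive1_comp R expR -%R u (expR (- u)) (-1) (is_derive_expR _).
  by rewrite mulrN1; apply; exact: is_deriveNid.
have d0 := lt0r_neq0 (den_gt0 u).
have dD : is_derive u 1 (fun x => expR x + expR (- x)) (expR u - expR (- u)).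
  exact: is_deriveD.
have dB : is_derive u 1 (fun x => expR x - expR (- x)) (expR u + expR (- u)).
  by rewrite -[X in is_derive _ _ _ (_ + X)]opprK; exact: is_deriveB.
have dV := @is_deriveV _ (fun x => expR x + expR (- x)) u _ _ d0 dD.
apply: is_derive_eq (is_deriveM dB dV) _.
by rewrite /tanh /GRing.scale /=; field.
Qed.

Lemma tanh_continuous : continuous (@tanh R).
Proof.
move=> u; apply/differentiable_continuous/derivable1_diffP.
by case: (is_derive_tanh u).
Qed.

(** The derivative 1 - tanh^2 lies in [0, 1]. *)
Lemma tanh_lipschitz u v : `|tanh u - tanh v| <= `|u - v|.
Proof.
wlog vu : u v / v <= u => [H|].
  by case: (leP v u) => [|/ltW] /H//; rewrite distrC [leRHS]distrC.
have [c _ ->] := MVT_segment vu (fun x _ => is_derive_tanh x)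
  (continuous_subspaceT tanh_continuous).
rewrite normrM ler_piMl// ger0_norm ?gerBl ?sqr_ge0// subr_ge0.
by rewrite -real_normK ?num_real// expr_le1// normr_tanh_le1.
Qed.

End tanh_theory.

(** * Reduction of suprema over an interval to finite grids *)

Section grid.
Context {R : realType}.
Implicit Types (U s C : R) (K : nat).

(** The index is the integer part of s divided by the mesh. It reaches [K.+1] only at s = U, which
    accounts for the extra terms in the two sums below. *)
Lemma grid_point U K s : 0 < U -> 0 <= s <= U ->
  exists2 k : nat, (k <= K.+1)%N &
    k%:R * (U / K.+1%:R) <= s < k.+1%:R * (U / K.+1%:R).
Proof.
move=> U0 /andP[s0 sU]; have h0 : 0 < U / K.+1%:R by rewrite divr_gt0.
exists (Num.trunc (s / (U / K.+1%:R))).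
  rewrite truncn_le_nat ltr_pdivrMr// (le_lt_trans sU)//.
  rewrite mulrCA ltr_pMr// ltr_pdivlMr// mul1r ltr_nat//.
have /andP[h1 h2] := truncn_itv (divr_ge0 s0 (ltW h0)).
by rewrite -ler_pdivlMr// h1 -ltr_pdivrMr.
Qed.

(** A sum replaces the maximum over the grid because its mean is bounded term by term. *)
Let le_grid_sum (f : nat -> R) K k : (forall i, 0 <= f i) -> (k < K)%N ->
  f k <= \sum_(i < K) f i.
Proof.
move=> f0 kK; rewrite (bigD1 (Ordinal kK))//= lerDl.
by apply: sumr_ge0 => i _.
Qed.

Lemma lipschitz_grid (g : R -> R) U C K : 0 < U -> 0 <= C ->
  (forall s t, 0 <= s -> 0 <= t -> `|g s - g t| <= C * `|s - t|) ->
  forall s, 0 <= s <= U ->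
  `|g s| <= \sum_(k < K.+2) `|g (k%:R * (U / K.+1%:R))| + C * (U / K.+1%:R).
Proof.
move=> U0 C0 gC s sU; have [k kK /andP[ks sk]] := grid_point K U0 sU.
set h := U / _ in ks sk *; have h0 : 0 <= h by rewrite divr_ge0// ltW.
rewrite -[g s](subrK (g (k%:R * h))) addrC.
apply: le_trans (ler_normD _ _) _; apply: lerD.
  exact: (@le_grid_sum (fun k => `|g (k%:R * h)|)).
apply: le_trans (gC _ _ _ _) _; [by case/andP: sU|by rewrite mulr_ge0|].
rewrite ler_wpM2l// ger0_norm ?subr_ge0// lerBlDr; move: sk.
by rewrite -natr1 mulrDl mul1r addrC => /ltW.
Qed.

(** Monotonicity squeezes Y s between its values at both neighbouring grid points. For s = U the
    right neighbour has index [K.+2] and lies beyond U, hence [K.+3] terms. *)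
Lemma nondecreasing_grid (Y : R -> R) U K : 0 < U ->
  (forall s t, 0 <= s -> s <= t -> Y s <= Y t) ->
  forall s, 0 <= s <= U ->
  `|Y s - s| <= \sum_(k < K.+3) `|Y (k%:R * (U / K.+1%:R)) - k%:R * (U / K.+1%:R)|
    + U / K.+1%:R.
Proof.
move=> U0 Ynd s sU; have [k kK /andP[ks sk]] := grid_point K U0 sU.
set h := U / _ in ks sk *; have h0 : 0 <= h by rewrite divr_ge0// ltW.
set S := \sum_(i < _) _.
have Sk i : (i < K.+3)%N -> `|Y (i%:R * h) - i%:R * h| <= S.
  exact: (@le_grid_sum (fun k => `|Y (k%:R * h) - k%:R * h|)).
have := Sk k (leqW kK); have := Sk k.+1 kK; rewrite !ler_norml.
have kh0 : 0 <= k%:R * h by rewrite mulr_ge0.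
have := Ynd _ _ kh0 ks; have := Ynd _ _ (le_trans kh0 ks) (ltW sk).
move: sk ks; rewrite -natr1 mulrDl mul1r => *; apply/andP; split; lra.
Qed.

End grid.

(** * The limit equation *)

Section interval_calculus.
Context {R : realType}.
Local Notation mu := (@lebesgue_measure R).
Implicit Types (f : R -> R) (t : R).

Lemma within_itvcyW f t : 0 <= t ->
  {within `[0, +oo[, continuous f} -> {within `[0, t], continuous f}.
Proof.
move=> t0; apply: continuous_subspaceW => s /=.
by rewrite !in_itv/= andbT => /andP[].
Qed.

Lemma within_itvcy_right f t : 0 <= t ->
  {within `[0, +oo[, continuous f} -> f s @[s --> t^'+] --> f t.
Proof.
move=> t0 /continuous_within_itvcyP[ct c0].
move: t0; rewrite le_eqVlt => /predU1P[<-//|t0].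
by apply: cvg_at_right_filter; apply: ct; rewrite in_itv/= t0.
Qed.

Lemma continuous_itv_integrable f t : 0 <= t ->
  {within `[0, +oo[, continuous f} -> mu.-integrable `[0, t] (EFin \o f).
Proof.
move=> t0 /(within_itvcyW t0) cf; apply: continuous_compact_integrable => //.
exact: segment_compact.
Qed.

Lemma lebesgue_itv0 t : 0 <= t -> mu `[0, t] = t%:E.
Proof.
move=> t0; have := lebesgue_measure_itv `[0%R, t]; rewrite /= lte_fin => ->.
by move: t0; rewrite le_eqVlt => /predU1P[<-|->]; rewrite ?ltxx// oppr0 adde0.
Qed.

(** The constant extension to negative times keeps the Lipschitz bound on the whole line. *)
Lemma lipschitz_within f C : (forall s t, 0 <= s -> 0 <= t ->
  `|f s - f t| <= C * `|s - t|) -> {within `[0, +oo[, continuous f}.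
Proof.
move=> fC; pose g s := f (Num.max 0 s).
have C0 : 0 <= C.
  have := fC 1 0 ler01 (lexx _); rewrite subr0 normr1 mulr1.
  exact: le_trans.
have gC s t : `|g s - g t| <= C * `|s - t|.
  apply: le_trans (fC _ _ _ _) _; rewrite ?le_max ?lexx// ler_wpM2l//.
  have := ler_norm (s - t); have := ler_norm (t - s); rewrite (distrC t s) ler_norml.
  by case: (leP 0 s) => ?; case: (leP 0 t) => ? ? ?; apply/andP; split; lra.
have cg : continuous g.
  move=> t; apply/(@cvgrPdist_le _ R^o) => e e0.
  have d0 : 0 < e / (C + 1) by rewrite divr_gt0// ltr_wpDl.
  have near_t : \forall s \near t, `|t - s| <= e / (C + 1).
    by exists (e / (C + 1)) => // s /= /ltW.
  apply: filterS near_t => s ts; apply: le_trans (gC _ _) _.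
  have /le_trans : C * `|t - s| <= C * (e / (C + 1)) by rewrite ler_wpM2l.
  apply; rewrite mulrCA ler_piMr ?ltW// ltr_pdivrMr ?mul1r ?ltrDl//.
  by rewrite ltr_wpDl.
have : {within `[0, +oo[, continuous g} by exact: continuous_subspaceT.
apply: subspace_eq_continuous => s; rewrite inE/= in_itv/= andbT => s0.
by rewrite /from_subspace /g max_r.
Qed.

End interval_calculus.

Section limit_solution_theory.
Context {R : realType} (beta1 beta2 p sstar : R) (m : R -> R -> R).
Hypothesis Hm : limit_solution beta1 beta2 p sstar m.
Local Notation mu := (@lebesgue_measure R).
Local Notation nu := (normal_prob 0 sstar).

Let limit_within_continuous x : {within `[0, +oo[, continuous (m ^~ x)} :=
  @limit_continuous_time _ _ _ _ _ _ Hm x.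

Let nuT : nu setT = 1%E.
Proof. exact: (@probability_setT _ _ _ (normal_prob 0 sstar)). Qed.

Definition limit_mean (t : R) : R := \int[nu]_y m t y.

Lemma limit_space_measurable t : 0 <= t -> measurable_fun setT (m t).
Proof.
move=> t0; apply: continuous_measurable_fun.
exact: (limit_continuous_space Hm).
Qed.

Lemma limit_norm t x : 0 <= t -> `|m t x| <= 1.
Proof. by move=> t0; rewrite ler_norml; exact: (limit_values Hm). Qed.

(** The right-hand side of the limit equation is at most 2 + 2 in absolute value, uniformly in x and
    [sstar]. This uniformity keeps the constants independent of N when [sstar] varies. *)
Lemma limit_lipschitz x s t : 0 <= s -> 0 <= t ->
  `|m s x - m t x| <= 4 * `|s - t|.
Proof.
move=> s0 t0; wlog st : s t s0 t0 / t <= s => [H|].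
  by case: (leP t s) => [|/ltW] st; [|rewrite distrC (distrC s)]; exact: H.
pose v u := 2 * tanh (beta1 * (x + m u x) + beta2 * limit_mean u) - 2 * m u x.
have [|c|c] := @MVT_segment R (m ^~ x) v t s st.
- move=> u; rewrite in_itv/= => /andP[tu _].
  by apply: (limit_ode Hm); exact: le_lt_trans tu.
- apply: (continuous_subspaceW _ (@limit_within_continuous x)) => u /=.
  by rewrite !in_itv/= andbT => /andP[tu _]; exact: le_trans tu.
rewrite in_itv/= => /andP[tc _] ->; rewrite /v.
have := limit_norm x (le_trans t0 tc).
have := normr_tanh_le1 (beta1 * (x + m c x) + beta2 * limit_mean c).
move: (tanh _) => a; move: (m c x) => b a1 b1.
rewrite normrM ler_wpM2r//; apply: le_trans (ler_normB _ _) _.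
rewrite !normrM (ger0_norm (ler0n _ 2)); lra.
Qed.

Lemma limit_integrable t : 0 <= t -> nu.-integrable setT (EFin \o m t).
Proof.
move=> t0; apply: measurable_bounded_integrable => //.
- by have : (nu setT < +oo)%E by rewrite nuT ltry.
- exact: limit_space_measurable.
- exists 1; split=> // c c1 x _ /=.
  exact: le_trans (limit_norm x t0) (ltW c1).
Qed.

Lemma limit_mean_lipschitz s t : 0 <= s -> 0 <= t ->
  `|limit_mean s - limit_mean t| <= 4 * `|s - t|.
Proof.
move=> s0 t0; rewrite /limit_mean -RintegralB//; [|exact: limit_integrable..].
have iB : nu.-integrable setT (EFin \o (fun x => m s x - m t x)).
  by have := integrableB measurableT (limit_integrable s0) (limit_integrable t0).
apply: le_trans (le_normr_Rintegral measurableT iB) _.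
apply: le_trans (_ : \int[nu]_x (4 * `|s - t|) <= _).
  apply: le_Rintegral => //.
  - exact: integrable_norm.
  - exact: finite_measure_integrable_cst.
  - by move=> x _; exact: limit_lipschitz.
by rewrite Rintegral_cst// [fine _](_ : _ = 1) ?mulr1//; exact: (congr1 fine nuT).
Qed.

Lemma limit_drift_continuous x : {within `[0, +oo[, continuous (fun s =>
  2 * tanh (beta1 * (x + m s x) + beta2 * limit_mean s) - 2 * m s x)}.
Proof.
have cM := lipschitz_within limit_mean_lipschitz.
have cm := @limit_within_continuous x.
move=> s; apply: cvgB; last by apply: cvgM; [exact: cvg_cst|exact: cm].
apply: cvgM; first exact: cvg_cst.
apply: (cvg_comp (fun s => beta1 * (x + m s x) + beta2 * limit_mean s) (@tanh R));
  last exact: tanh_continuous.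
have F : Filter (nbhs_subspace s) by exact: nbhs_subspace_filter.
apply: cvgD.
  apply: cvgM; [exact: cvg_cst|apply: cvgD; [exact: cvg_cst|exact: cm]].
by apply: cvgM; [exact: cvg_cst|exact: cM].
Qed.

(** The differential equation is given for t > 0; continuity at 0 lets the fundamental theorem of
    calculus reach the left end point. *)
Lemma limit_integral_equation x t : 0 <= t -> m t x = 2 * p - 1 +
  \int[mu]_(s in `[0, t])
    (2 * tanh (beta1 * (x + m s x) + beta2 * limit_mean s) - 2 * m s x).
Proof.
rewrite le_eqVlt => /predU1P[<-|t0].
  by rewrite set_itv1 Rintegral_set1 addr0 (limit0 Hm).
rewrite /Rintegral (@continuous_FTC2 _ _ (m ^~ x) _ _ t0)//=.
- by rewrite (limit0 Hm); ring.
- by apply: within_itvcyW; [exact: ltW|exact: limit_drift_continuous].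
- have := within_itvcyW (ltW t0) (@limit_within_continuous x).
  move=> /(continuous_within_itvP _ t0)[_ h0 ht]; split => // u.
  rewrite in_itv/= => /andP[u0 _].
  by case: (limit_ode Hm x u0).
- move=> u; rewrite in_itv/= => /andP[u0 _]; rewrite derive1E.
  by case: (limit_ode Hm x u0) => _ ->.
Qed.

End limit_solution_theory.

(** * The diffusions *)

Section average_theory.
Context {R : realType} (N : nat).
Local Notation mu := (@lebesgue_measure R).
Implicit Types (a b : 'I_N.+1 -> R) (f : 'I_N.+1 -> R -> R).

Lemma averageD a b : average (fun i => a i + b i) = average a + average b.
Proof. by rewrite /average big_split/= mulrDl. Qed.

Lemma averageZ (k : R) a : average (fun i => k * a i) = k * average a.
Proof. by rewrite /average -mulr_sumr mulrA. Qed.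

Lemma average_cst (k : R) : average (fun _ : 'I_N.+1 => k) = k.
Proof. by rewrite /average sumr_const card_ord -[k *+ _]mulr_natr mulfK. Qed.

Lemma averageB a b : average (fun i => a i - b i) = average a - average b.
Proof. by rewrite /average sumrB mulrBl. Qed.

Lemma le_average a b : (forall i, a i <= b i) -> average a <= average b.
Proof. by move=> ab; rewrite /average ler_wpM2r// ler_sum. Qed.

Lemma ler_norm_average a : `|average a| <= average (fun i => `|a i|).
Proof. by rewrite /average normrM [`|_^-1|]ger0_norm// ler_wpM2r// ler_norm_sum. Qed.

Lemma average_ge0 a : (forall i, 0 <= a i) -> 0 <= average a.
Proof. by move=> a0; rewrite /average mulr_ge0// sumr_ge0. Qed.

Lemma average_continuous f : (forall i, {within `[0, +oo[, continuous (f i)}) ->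
  {within `[0, +oo[, continuous (fun t => average (f ^~ t))}.
Proof.
move=> cf s; have F : Filter (nbhs_subspace s) by exact: nbhs_subspace_filter.
apply: cvgM; last exact: cvg_cst.
apply: (cvg_big _ _ _) => [|i _]; [exact: add_continuous|exact: cf].
Qed.

Lemma Rintegral_average f (D : set R) : measurable D ->
  (forall i, mu.-integrable D (EFin \o f i)) ->
  \int[mu]_(t in D) average (f ^~ t) = average (fun i => \int[mu]_(t in D) f i t).
Proof.
move=> mD fi; rewrite /average.
have si (s : seq 'I_N.+1) :
    mu.-integrable D (EFin \o (fun t => \sum_(i <- s) f i t)).
  rewrite (_ : _ \o _ = fun t => (\sum_(i <- s) (f i t)%:E)%E); last first.
    by apply/funext => t /=; rewrite sumEFin.
  by apply: integrable_sum => // i _; exact: fi.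
rewrite RintegralZr//; congr (_ * _).
elim: (index_enum _) => [|i s IH].
  rewrite big_nil; under eq_Rintegral do rewrite big_nil.
  by rewrite Rintegral_cst// mul0r.
by rewrite big_cons -IH; under eq_Rintegral do rewrite big_cons; rewrite RintegralD.
Qed.

End average_theory.

Section interval_integrals.
Context {R : realType}.
Local Notation mu := (@lebesgue_measure R).
Implicit Types (f g : R -> R) (t T k c : R).

Lemma measurable_itv0 T : measurable (`[0, T]%classic : set (measurableTypeR R)).
Proof. exact: measurable_itv. Qed.

Lemma integrable_itv_cst k T : 0 <= T -> mu.-integrable `[0, T] (EFin \o cst k).
Proof.
move=> T0; apply: measurable_bounded_integrable => //.
- by have : (mu `[0%R, T] < +oo)%E by rewrite lebesgue_itv0// ltry.
- by exists `|k|; split; [exact: num_real|move=> c kc u _; exact: ltW].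
Qed.

Lemma integrable_itv_affine k c f T : 0 <= T -> mu.-integrable `[0, T] (EFin \o f) ->
  mu.-integrable `[0, T] (EFin \o (fun t => k + c * f t)).
Proof.
move=> T0 fi.
have := integrableD (measurable_itv0 T) (integrable_itv_cst k T0)
  (integrableZl (measurable_itv0 T) c fi).
by apply: eq_integrable.
Qed.

Lemma Rintegral_itv_affine k c f T : 0 <= T -> mu.-integrable `[0, T] (EFin \o f) ->
  \int[mu]_(t in `[0, T]) (k + c * f t) = T * k + c * \int[mu]_(t in `[0, T]) f t.
Proof.
move=> T0 fi; rewrite RintegralD//.
- rewrite Rintegral_cst//; congr (_ + _); last by rewrite RintegralZl.
  by rewrite mulrC; congr (_ * _); exact: (congr1 fine (lebesgue_itv0 T0)).
- exact: integrable_itv_cst.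
- by have := integrableZl (measurable_itv0 T) c fi; apply: eq_integrable.
Qed.

Lemma Rintegral_itv_le f t T : 0 <= t <= T -> (forall u, 0 <= f u) ->
  mu.-integrable `[0, T] (EFin \o f) ->
  \int[mu]_(u in `[0, t]) f u <= \int[mu]_(u in `[0, T]) f u.
Proof.
move=> /andP[t0 tT] f0 fi.
have sub : `[0, t] `<=` `[0, T] by apply: subset_itvl; rewrite bnd_simp.
have fit : mu.-integrable `[0, t] (EFin \o f) by exact: integrableS fi.
rewrite /Rintegral fine_le//.
- exact: (integrable_fin_num (measurable_itv0 t) fit).
- exact: (integrable_fin_num (measurable_itv0 T) fi).
- apply: ge0_subset_integral => //; first exact: measurable_int fi.
  by move=> u _; rewrite lee_fin.
Qed.

End interval_integrals.

(** * Pathwise estimates for the diffusions *)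

Section diffusion_path.
Context {R : realType} (N : nat) (x W : 'I_N.+1 -> R -> R) (a s T : R).
Local Notation mu := (@lebesgue_measure R).
Hypotheses (a0 : 0 <= a) (s0 : 0 <= s) (T0 : 0 <= T) (aT : a * T <= 1 / 2).
Hypothesis cx : forall i, {within `[0, +oo[, continuous (x i)}.
Hypothesis cW : forall i, {within `[0, +oo[, continuous (W i)}.
Let X t := average (x ^~ t).
Hypothesis ex : forall i t, 0 <= t ->
  x i t = x i 0 - a * \int[mu]_(u in `[0, t]) (x i u - X u) + s * W i t.
Let B i := \int[mu]_(t in `[0, T]) `|W i t|.

Let cX : {within `[0, +oo[, continuous X}.
Proof. exact: average_continuous. Qed.

Let y i t := x i t - X t.

Let cy i : {within `[0, +oo[, continuous (y i)}.
Proof. by move=> t; apply: cvgB; [exact: cx|exact: cX]. Qed.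

Let continuous_norm (f : R -> R) : {within `[0, +oo[, continuous f} ->
  {within `[0, +oo[, continuous (fun t : R => `|f t| : R)}.
Proof. by move=> cf t; apply: cvg_norm; exact: cf. Qed.

Let integrable_norm (f : R -> R) : {within `[0, +oo[, continuous f} ->
  mu.-integrable `[0, T] (EFin \o (fun t => `|f t|)).
Proof. by move=> /continuous_norm cf; exact: continuous_itv_integrable. Qed.

(* The mean-field drift averages out. *)
Lemma diffusion_average t : 0 <= t -> X t = X 0 + s * average (W ^~ t).
Proof.
move=> t0; rewrite {1}/X (_ : (fun i => x i t) = fun i =>
    x i 0 - a * \int[mu]_(u in `[0, t]) y i u + s * W i t); last first.
  by apply/funext => i; exact: ex.
rewrite averageD averageB !averageZ -Rintegral_average//; last first.
  by move=> i; exact: continuous_itv_integrable.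
have -> : \int[mu]_(u in `[0, t]) average (y ^~ u) = 0.
  under eq_Rintegral do rewrite averageB average_cst subrr.
  by rewrite Rintegral_cst// mul0r.
by rewrite mulr0 subr0.
Qed.

Lemma diffusion_average_integral :
  \int[mu]_(t in `[0, T]) `|X t| <= T * `|X 0| + s * average B.
Proof.
have iW := integrable_norm (@cW _).
have iaW : mu.-integrable `[0, T] (EFin \o (fun t => average (fun i => `|W i t|))).
  apply: continuous_itv_integrable => //.
  by apply: average_continuous => i; exact: continuous_norm.
rewrite -Rintegral_average// -Rintegral_itv_affine//.
apply: le_Rintegral => //.
- exact: integrable_norm.
- exact: integrable_itv_affine.
- move=> t; rewrite /= in_itv/= => /andP[t0 _]; rewrite diffusion_average//.
  apply: le_trans (ler_normD _ _) _; rewrite lerD2l normrM ger0_norm//.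
  by rewrite ler_wpM2l// ler_norm_average.
Qed.

(** Let I be the integral of |x_i - X|. The integral equation bounds the displacement by a I plus
    noise, and I in turn by the displacement plus |x_i(0)| and |X|. The resulting term a T I is at
    most I / 2 and is absorbed, which produces the factor 2. *)
Lemma diffusion_displacement i :
  \int[mu]_(t in `[0, T]) `|x i t - x i 0| <=
  a * T * (2 * (T * `|x i 0| + T * `|X 0| + s * (B i + average B))) + s * B i.
Proof.
pose I := \int[mu]_(t in `[0, T]) `|y i t|.
have iW := integrable_norm (@cW i).
have iX := integrable_norm cX.
have I0 : 0 <= I by exact: Rintegral_ge0.
have xE t : 0 <= t <= T -> `|x i t - x i 0| <= a * I + s * `|W i t|.
  move=> tT; have t0 : 0 <= t by case/andP: tT.
  rewrite ex// addrAC [x i 0 - _]addrC addrK addrC.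
  apply: le_trans (ler_normB _ _) _; rewrite addrC; apply: lerD; last first.
    by rewrite normrM (ger0_norm s0).
  rewrite normrM (ger0_norm a0) ler_wpM2l//.
  have iy : mu.-integrable `[0, t] (EFin \o y i).
    exact: continuous_itv_integrable.
  apply: (le_trans (le_normr_Rintegral (measurable_itv0 t) iy)).
  by apply: Rintegral_itv_le => //; exact: integrable_norm.
have h1 : \int[mu]_(t in `[0, T]) `|x i t - x i 0| <= T * (a * I) + s * B i.
  rewrite -Rintegral_itv_affine//; apply: le_Rintegral => //.
  - apply: integrable_norm => t.
    by apply: cvgB; [exact: cx|exact: cvg_cst].
  - exact: integrable_itv_affine.
have h2 : I <= T * (`|x i 0| + a * I) + s * B i + (T * `|X 0| + s * average B).
  apply: le_trans (lerD (lexx _) diffusion_average_integral).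
  rewrite -Rintegral_itv_affine// -RintegralD//; last exact: integrable_itv_affine.
  apply: le_Rintegral => //.
  - exact: integrable_norm.
  - have := integrableD (measurable_itv0 T)
      (integrable_itv_affine (`|x i 0| + a * I) s T0 iW) iX.
    by apply: eq_integrable.
  - move=> t; rewrite /= in_itv/= => /xE xt.
    rewrite /y; apply: le_trans (ler_normB _ _) _; rewrite lerD2r.
    rewrite -[x i t](subrK (x i 0)) addrC -addrA.
    by apply: le_trans (ler_normD _ _) _; rewrite lerD2l.
have h3 : a * T * I <= 1 / 2 * I by rewrite ler_wpM2r.
apply: le_trans h1 _; rewrite lerD2r mulrA [T * a]mulrC ler_wpM2l ?mulr_ge0//.
move: h2 h3; rewrite mulrDr mulrA [T * a]mulrC mulrDr; lra.
Qed.

End diffusion_path.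

(** * The spins *)

(** If the set is unbounded, [sup] is 0 by convention; otherwise it dominates the value at time
    0. *)
Lemma sup_norm_ge0 {R : realType} (f : R -> R) (T : R) : 0 <= T ->
  0 <= sup [set `|f t| | t in `[0, T]].
Proof.
move=> T0; have [hs|/sup_out ->//] := pselect (has_sup [set `|f t| | t in `[0, T]]).
apply: le_trans (normr_ge0 (f 0)) _; apply: sup_upper_bound => //.
by exists 0 => //; rewrite /= in_itv/= lexx.
Qed.

(** * Contraction in an exponentially weighted norm *)

Section weighted_gronwall.
Context {R : realType}.
Local Notation mu := (@lebesgue_measure R).

(** Dropping the lower end point of the primitive leaves the factor 1 / l, the source of the
    contraction. *)
Lemma integral_expR_le (l t : R) : 0 < l -> 0 <= t ->
  \int[mu]_(s in `[0, t]) expR (l * s) <= expR (l * t) / l.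
Proof.
move=> l0; rewrite le_eqVlt => /predU1P[<-|t0].
  by rewrite set_itv1 Rintegral_set1 divr_ge0 ?expR_ge0// ltW.
have dF (s : R) : is_derive s (1 : R) (fun s => l^-1 * expR (l * s)) (expR (l * s)).
  have dl : is_derive s (1 : R) ( *%R l) l.
    by have := is_deriveZ l (@is_derive_id _ _ s 1); rewrite /GRing.scale/= mulr1.
  have dE := @is_derive1_comp R expR ( *%R l) s _ _ (is_derive_expR _) dl.
  apply: is_derive_eq (is_deriveZ l^-1 dE) _.
  by rewrite /GRing.scale/=; field; rewrite gt_eqF.
have cF : continuous (fun s => l^-1 * expR (l * s)).
  by move=> s; apply/differentiable_continuous/derivable1_diffP; case: (dF s).
have cE : continuous (fun s : R => expR (l * s)).
  move=> s; apply: (cvg_comp ( *%R l) expR); last exact: continuous_expR.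
  exact: mulrl_continuous.
rewrite /Rintegral (@continuous_FTC2 _ _ (fun s => l^-1 * expR (l * s)) _ _ t0)/=.
- by rewrite mulrC lerBlDr lerDl mulr_ge0 ?expR_ge0// invr_ge0 ltW.
- exact: continuous_subspaceT.
- split; first by move=> s _; case: (dF s).
  + by apply: cvg_at_right_filter; exact: cF.
  + by apply: cvg_at_left_filter; exact: cF.
- by move=> s _; rewrite derive1E; case: (dF s) => _ ->.
Qed.

Context (N : nat) (u : 'I_N.+1 -> R -> R) (G : 'I_N.+1 -> R) (b c l C T : R).
Hypotheses (c0 : 0 <= c) (b0 : 0 <= b) (l0 : 0 < l) (T0 : 0 <= T).
Hypothesis cbl : 2 * (c + b) <= l.
Hypothesis u0 : forall i t, 0 <= t <= T -> 0 <= u i t <= C.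

(* Instead of Gronwall's inequality, use the norm [sup e^(-l t) u t], for which
   the integral operator is a contraction. *)
Lemma weighted_gronwall :
  (forall S : 'I_N.+1 -> R,
    (forall i t, 0 <= t <= T -> u i t <= S i * expR (l * t)) ->
    forall i t, 0 <= t <= T ->
      u i t <= G i + (c * S i + b * average S) * (expR (l * t) / l)) ->
  (forall i, 0 <= G i) ->
  forall i t, 0 <= t <= T -> u i t <= 2 * expR (l * T) * (G i + average G).
Proof.
move=> step G0.
pose E i := [set expR (- (l * t)) * u i t | t in `[0, T]].
pose S i := sup (E i).
have T00 : `[0, T]%classic 0 by rewrite /= in_itv/= lexx.
(* The bound [C] makes the weighted suprema finite, so that they can be absorbed below; it does not
   enter the conclusion. *)
have hE i : has_sup (E i).
  split; first by exists (expR (- (l * 0)) * u i 0), 0.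
  exists C => _ [t tT <-]; move: tT; rewrite /= in_itv/= => tT.
  have /andP[ut0 utC] := u0 i tT; apply: le_trans utC.
  rewrite ler_piMl// -expR0 ler_expR oppr_le0 mulr_ge0 ?(ltW l0)//.
  by case/andP: tT.
have uS i t : 0 <= t <= T -> u i t <= S i * expR (l * t).
  move=> tT; rewrite -ler_pdivrMr ?expR_gt0// -expRN mulrC.
  by apply: sup_upper_bound => //; exists t => //=; rewrite in_itv.
have S0 i : 0 <= S i.
  have TT : 0 <= (0 : R) <= T by rewrite lexx.
  have := uS i 0 TT; rewrite mulr0 expR0 mulr1; apply: le_trans.
  by case/andP: (u0 i TT).
have Sbar0 : 0 <= average S by exact: average_ge0.
have SG i : S i <= G i + (c * S i + b * average S) / l.
  apply: ge_sup; first by exists (expR (- (l * 0)) * u i 0), 0.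
  move=> _ [t tT <-]; move: tT; rewrite /= in_itv/= => tT.
  rewrite expRN mulrC ler_pdivrMr ?expR_gt0//.
  apply: le_trans (step S uS i t tT) _; rewrite [leRHS]mulrDl.
  rewrite [expR _ / l]mulrC [in leLHS]mulrA lerD2r ler_peMr//.
  rewrite -expR0 ler_expR mulr_ge0 ?(ltW l0)//.
  by case/andP: tT.
(* Averaging over i gives a closed inequality for [average S], absorbed since (c + b) / l <= 1/2.
   Each [S i] is then treated with its average already known. *)
have SbarG : average S <= 2 * average G.
  have := le_average SG.
  rewrite averageD (_ : (fun i => (c * S i + b * average S) / l) =
    (fun i => l^-1 * (c * S i + b * average S))); last first.
    by apply/funext => i; rewrite mulrC.
  rewrite averageZ averageD averageZ average_cst -mulrDl.
  have : l^-1 * ((c + b) * average S) <= 2^-1 * average S.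
    rewrite mulrA ler_wpM2r// mulrC ler_pdivrMr// mulrC ler_pdivlMr//.
    by rewrite mulrC.
  lra.
move=> i t tT; have Gb0 : 0 <= average G by exact: average_ge0.
have Si : S i <= 2 * (G i + average G).
  have h1 : l^-1 * (c * S i) <= 2^-1 * S i.
    rewrite mulrA ler_wpM2r// mulrC ler_pdivrMr//.
    by move: cbl b0 c0; rewrite mulrDr => *; lra.
  have h2 : l^-1 * (b * average S) <= 2^-1 * average S.
    rewrite mulrA ler_wpM2r// mulrC ler_pdivrMr//.
    by move: cbl b0 c0; rewrite mulrDr => *; lra.
  have := SG i; rewrite [_ / l]mulrC mulrDr; lra.
apply: le_trans (uS i t tT) _; rewrite mulrAC ler_pM ?expR_ge0//.
by rewrite ler_expR ler_wpM2l ?(ltW l0)//; case/andP: tT.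
Qed.

End weighted_gronwall.

Section right_continuous_paths.
Context {R : realType}.
Local Notation mu := (@lebesgue_measure R).

(** A path is a process that does not depend on the sample point, so joint measurability of
    right-continuous processes applies, composed with s |-> (s, 0). *)
Lemma right_continuous_measurable (f : R -> R) :
  (forall t, 0 <= t -> f s @[s --> t^'+] --> f t) ->
  measurable_fun (`[0, +oo[%classic : set (measurableTypeR R)) f.
Proof.
move=> rcf.
have mf : measurable_fun setT (fun s : measurableTypeR R => f (Num.max 0 s)).
  have h := @measurable_right_continuous_process _ R R (fun t _ => f t)
    (fun t _ => measurable_cst (f t)) (fun t _ t0 => rcf t t0).
  have hp : measurable_fun setT (fun s : measurableTypeR R => (s : R, 0 : R)).
    exact: measurable_fun_pair.
  exact: (measurableT_comp h hp).
apply: (@eq_measurable_fun _ _ (measurableTypeR R) R _ (fun s => f (Num.max 0 s))).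
  by move=> s; rewrite inE/= in_itv/= andbT => s0; rewrite max_r.
exact: measurable_funTS.
Qed.

Lemma bounded_itv_integrable (f : R -> R) (C t : R) : 0 <= t ->
  measurable_fun (`[0, +oo[%classic : set (measurableTypeR R)) f ->
  (forall s, 0 <= s -> `|f s| <= C) -> mu.-integrable `[0, t] (EFin \o f).
Proof.
move=> t0 mf fC; apply: measurable_bounded_integrable => //.
- by have : (mu `[0%R, t] < +oo)%E by rewrite lebesgue_itv0// ltry.
- apply: measurable_funS mf => //.
  by move=> s; rewrite /= !in_itv/= andbT => /andP[].
- exists C; split; first exact: num_real.
  move=> c Cc s; rewrite /= in_itv/= => /andP[s0 _].
  exact: le_trans (fC _ s0) (ltW Cc).
Qed.

End right_continuous_paths.

(** * Comparison of the spins with the limit along one path *)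

Section spin_path.
Context {R : realType} d {Omega : measurableType d} (w : Omega).
Context (N : nat) (b1 b2 p ss T : R) (x m : 'I_N.+1 -> R -> Omega -> R).
Context (Y : bool -> 'I_N.+1 -> R -> R) (ml : R -> R -> R).
Context (D : bool -> 'I_N.+1 -> R) (Q : 'I_N.+1 -> R) (Z L : R).
Local Notation mu := (@lebesgue_measure R).
Hypotheses (b1_ge0 : 0 <= b1) (b2_ge0 : 0 <= b2) (T0 : 0 <= T).
Hypothesis Hml : limit_solution b1 b2 p ss ml.
Hypothesis cx : forall i, {within `[0, +oo[, continuous (x i ^~ w)}.
Hypothesis rcm : forall i t, 0 <= t -> m i s w @[s --> t^'+] --> m i t w.
Hypothesis m_le1 : forall i t, 0 <= t -> `|m i t w| <= 1.
Let X t := average (fun i => x i t w).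
Let M t := average (fun i => m i t w).
Let rate := jump_rate b1 b2 x m.
Let clock up i t := \int[mu]_(s in `[0, t]) rate up i s w.
Hypothesis em : forall i t, 0 <= t -> m i t w = m i 0 w
  + 2 / N.+1%:R * (Y true i (clock true i t) - Y false i (clock false i t)).
Hypothesis HD : forall up i u, 0 <= u <= 2 * N.+1%:R * T -> `|Y up i u - u| <= D up i.
Hypothesis HQ : forall i, \int[mu]_(t in `[0, T]) `|x i t w - x i 0 w| <= Q i.
Hypothesis HZ : \int[mu]_(t in `[0, T]) `|X t| <= Z.
Hypothesis HL : forall s, 0 <= s <= T ->
  `|average (fun i => ml s (x i 0 w)) - limit_mean ss ml s| <= L.

Let tau i t := tanh (b1 * (x i t w + m i t w) + b2 * (X t + M t)).
Let dom : set (measurableTypeR R) := `[0, +oo[%classic.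

Let measurable_x i : measurable_fun dom (x i ^~ w).
Proof.
by apply: right_continuous_measurable => t t0; exact: within_itvcy_right.
Qed.

Let measurable_m i : measurable_fun dom (m i ^~ w).
Proof. by apply: right_continuous_measurable => t t0; exact: rcm. Qed.

Let measurable_tau i : measurable_fun dom (tau i).
Proof.
apply: measurableT_comp.
  by apply: continuous_measurable_fun; exact: tanh_continuous.
apply: measurable_funD; apply: measurable_funM => //; apply: measurable_funD => //;
  by apply: measurable_funM => //; apply: measurable_sum.
Qed.

Let rateE up i t : rate up i t w =
  N.+1%:R * ((1 - jump_sign up * m i t w) / 2) * (1 + jump_sign up * tau i t).
Proof. by []. Qed.

Let rate_bound up i t : 0 <= t -> 0 <= rate up i t w <= 2 * N.+1%:R.
Proof.
move=> t0; rewrite rateE; have := m_le1 i t0.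
have := normr_tanh_le1 (b1 * (x i t w + m i t w) + b2 * (X t + M t)).
rewrite -/(tau i t) !ler_norml => /andP[t1 t2] /andP[m1 m2].
have sg (z : R) : -1 <= z <= 1 -> -1 <= jump_sign up * z <= 1.
  by move=> /andP[z1 z2]; rewrite /jump_sign; case: up; apply/andP; split; lra.
have /andP[sm1 sm2] : -1 <= jump_sign up * m i t w <= 1 by apply: sg; rewrite m1.
have /andP[st1 st2] : -1 <= jump_sign up * tau i t <= 1 by apply: sg; rewrite t1.
move: (jump_sign up * m i t w) (jump_sign up * tau i t) sm1 sm2 st1 st2 => a b *.
have a01 : 0 <= (1 - a) / 2 <= 1 by apply/andP; split; lra.
have b02 : 0 <= 1 + b <= 2 by apply/andP; split; lra.
case/andP: a01 b02 => a3 a4 /andP[b3 b4].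
move: ((1 - a) / 2) (1 + b) a3 a4 b3 b4 => a' b' *.
apply/andP; split; first by rewrite !mulr_ge0.
by rewrite -mulrA mulrC ler_wpM2r// -[leRHS]mul1r ler_pM.
Qed.

Let measurable_rate up i : measurable_fun dom (fun t => rate up i t w).
Proof.
under eq_fun do rewrite rateE.
apply: measurable_funM.
- apply: measurable_funM => //; apply: measurable_funM => //.
  by apply: measurable_funB => //; apply: measurable_funM.
- by apply: measurable_funD => //; apply: measurable_funM.
Qed.

Let integrable_rate up i t : 0 <= t ->
  mu.-integrable `[0, t] (EFin \o (fun s => rate up i s w)).
Proof.
move=> t0; apply: (@bounded_itv_integrable _ _ (2 * N.+1%:R)) => // s s0.
by have /andP[r0 r1] := rate_bound up i s0; rewrite ger0_norm.
Qed.

(** This deterministic range is what allows the Poisson deviations [D] to be taken without regard to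
    the dependence between clocks and noises. *)
Let clock_bound up i t : 0 <= t <= T -> 0 <= clock up i t <= 2 * N.+1%:R * T.
Proof.
move=> /andP[t0 tT]; apply/andP; split.
  apply: Rintegral_ge0 => s; rewrite /= in_itv/= => /andP[s0 _].
  by case/andP: (rate_bound up i s0).
(* The summand 0 * 0 gives the constant the shape expected by [Rintegral_itv_affine]. *)
apply: (@le_trans _ _ (\int[mu]_(s in `[0, t]) (2 * N.+1%:R + 0 * 0))).
  apply: le_Rintegral => //.
  - exact: integrable_rate.
  - by rewrite mul0r addr0; exact: integrable_itv_cst.
  - move=> s; rewrite /= in_itv/= => /andP[s0 _]; rewrite mul0r addr0.
    by case/andP: (rate_bound up i s0).
rewrite Rintegral_itv_affine//; last exact: integrable_itv_cst.
by rewrite mul0r addr0 mulrC ler_wpM2l// mulr_ge0.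
Qed.

Let integrable_tau_m i t : 0 <= t ->
  mu.-integrable `[0, t] (EFin \o (fun s => 2 * tau i s - 2 * m i s w)).
Proof.
move=> t0; apply: (@bounded_itv_integrable _ _ 4) => //.
  by apply: measurable_funB; apply: measurable_funM.
move=> s s0; apply: le_trans (ler_normB _ _) _.
have := m_le1 i s0.
have := normr_tanh_le1 (b1 * (x i s w + m i s w) + b2 * (X s + M s)).
rewrite -/(tau i s); move: (tau i s) (m i s w) => a b.
rewrite !normrM (ger0_norm (ler0n _ 2)); lra.
Qed.

(** In the upward minus the downward rate the products m tau cancel, leaving N (tau - m). With the
    jump size 2/N this is the drift 2 tau - 2 m of the limit equation. *)
Let clock_diff i t : 0 <= t -> clock true i t - clock false i t =
  N.+1%:R / 2 * \int[mu]_(s in `[0, t]) (2 * tau i s - 2 * m i s w).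
Proof.
move=> t0; rewrite -RintegralB//; try exact: integrable_rate.
rewrite -RintegralZl//; last exact: integrable_tau_m.
by apply: eq_Rintegral => s _; rewrite !rateE /jump_sign; field.
Qed.

Let u i t := `|m i t w - ml t (x i 0 w)|.
Let taul i t := tanh (b1 * (x i 0 w + ml t (x i 0 w)) + b2 * limit_mean ss ml t).

(* Compensating the Poisson clocks leaves the difference of the two drifts. *)
Let spin_difference i t (g : R -> R) : 0 <= t <= T ->
  mu.-integrable `[0, t] (EFin \o g) ->
  (forall s, 0 <= s <= t -> 2 * `|tau i s - taul i s| + 2 * u i s <= g s) ->
  u i t <= `|m i 0 w - (2 * p - 1)| + 2 / N.+1%:R * (D true i + D false i)
    + \int[mu]_(s in `[0, t]) g s.
Proof.
move=> tT ig taug; have t0 : 0 <= t by case/andP: tT.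
have it := integrable_tau_m i t0.
have il : mu.-integrable `[0, t] (EFin \o (fun s => 2 * taul i s - 2 * ml s (x i 0 w))).
  apply: continuous_itv_integrable => //.
  exact: (limit_drift_continuous Hml).
have idiff : mu.-integrable `[0, t] (EFin \o (fun s =>
    (2 * tau i s - 2 * m i s w) - (2 * taul i s - 2 * ml s (x i 0 w)))).
  by have := integrableB (measurable_itv0 t) it il; apply: eq_integrable.
rewrite /u; have -> : m i t w - ml t (x i 0 w) = (m i 0 w - (2 * p - 1))
    + 2 / N.+1%:R * ((Y true i (clock true i t) - clock true i t)
                     - (Y false i (clock false i t) - clock false i t))
    + \int[mu]_(s in `[0, t])
        ((2 * tau i s - 2 * m i s w) - (2 * taul i s - 2 * ml s (x i 0 w))).
  rewrite em// (limit_integral_equation Hml _ t0).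
  rewrite (RintegralB (measurable_itv0 t) it il).
  have -> : \int[mu]_(s in `[0, t]) (2 * tau i s - 2 * m i s w) =
      2 / N.+1%:R * (clock true i t - clock false i t).
    by rewrite clock_diff//; field.
  rewrite /taul; ring.
apply: le_trans (ler_normD _ _) _; apply: lerD.
  apply: le_trans (ler_normD _ _) _; rewrite lerD2l normrM ger0_norm//.
  rewrite ler_wpM2l//; apply: le_trans (ler_normB _ _) _.
  by apply: lerD; apply: HD; exact: clock_bound.
apply: le_trans (le_normr_Rintegral (measurable_itv0 t) idiff) _.
apply: le_Rintegral => //.
- exact: integrable_norm.
- move=> s; rewrite /= in_itv/= => /taug; apply: le_trans.
  apply: le_trans (_ : `|2 * (tau i s - taul i s)
                         - 2 * (m i s w - ml s (x i 0 w))| <= _).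
    by rewrite le_eqVlt; apply/orP; left; apply/eqP; congr `| _ |; ring.
  apply: le_trans (ler_normB _ _) _.
  by rewrite !normrM (ger0_norm (ler0n _ 2)).
Qed.

(** Twice the sum of the coefficients [2 * b1 + 2] of the spin itself and [2 * b2] of the average:
    the contraction factor is 1/2. *)
Let l := 4 * (b1 + 1 + b2).
Let l0 : 0 < l.
Proof. by rewrite mulr_gt0// ltr_wpDr// ltr_wpDl. Qed.

(** The error sources stay separate: initial spins, compensated Poisson noise [D], displacement [Q]
    of the diffusion, size [Z] of the average X, and law of large numbers [L] for the limit spins.
    [Q] and [Z] are time integrals because x and X enter only through the integrated drift. *)
Lemma spin_path i t : 0 <= t <= T ->
  `|m i t w - ml t (x i 0 w)| <= 2 * expR (l * T) *
    (let G i := `|m i 0 w - (2 * p - 1)| + 2 / N.+1%:R * (D true i + D false i)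
        + 2 * b1 * Q i + 2 * b2 * Z + 2 * b2 * (T * L) in G i + average G).
Proof.
move=> tT /=; set G := fun i => _.
have cxi j : {within `[0, +oo[, continuous (fun s => `|x j s w - x j 0 w|)}.
  by move=> s; apply: cvg_norm; apply: cvgB; [exact: cx|exact: cvg_cst].
have cX : {within `[0, +oo[, continuous (fun s => `|X s|)}.
  by move=> s; apply: cvg_norm; exact: (average_continuous cx).
have cE : {within `[0, +oo[, continuous (fun s => expR (l * s))}.
  apply: continuous_subspaceT => s.
  by apply: (cvg_comp ( *%R l) expR); [exact: mulrl_continuous|exact: continuous_expR].
have D0 up j : 0 <= D up j.
  apply: le_trans (normr_ge0 (Y up j 0 - 0)) (HD _ _ _).
  by rewrite lexx !mulr_ge0.
have Q0 j : 0 <= Q j by apply: le_trans (HQ j); exact: Rintegral_ge0.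
have Z0 : 0 <= Z by apply: le_trans HZ; exact: Rintegral_ge0.
have L0 : 0 <= L by apply: le_trans (HL (s := 0) _); rewrite ?lexx.
have G0 j : 0 <= G j by rewrite /G !addr_ge0// !mulr_ge0// ?addr_ge0.
apply: (@weighted_gronwall _ _ u G (2 * b2) (2 * b1 + 2) l 2) => //.
- by rewrite addr_ge0 ?mulr_ge0.
- by rewrite mulr_ge0.
- by rewrite /l; lra.
- move=> j s /andP[s0 _]; rewrite normr_ge0/=; apply: le_trans (ler_normB _ _) _.
  by have := m_le1 j s0; have := limit_norm Hml (x j 0 w) s0; lra.
move=> S uS j s sT; have /andP[s0 sT'] := sT.
pose k := (2 * b1 + 2) * S j + 2 * b2 * average S.
pose c0 := 2 * b2 * L.
(* A majorant of the difference of drifts in which the unknown errors appear only through the weight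
   e^(l r); the leading zeros fit the affine integration lemma. *)
pose g r := (c0 + 2 * b1 * `|x j r w - x j 0 w|)
  + (0 + 2 * b2 * `|X r|) + (0 + k * expR (l * r)).
have int0 (f : R -> R) : {within `[0, +oo[, continuous f} -> forall r, 0 <= r ->
    mu.-integrable `[0, r] (EFin \o f).
  by move=> cf r r0; exact: continuous_itv_integrable.
have S0 i' : 0 <= S i'.
  have := uS i' 0; rewrite lexx T0 mulr0 expR0 mulr1 => /(_ isT).
  by apply: le_trans; exact: normr_ge0.
have k0 : 0 <= k.
  by rewrite addr_ge0// mulr_ge0 ?addr_ge0 ?average_ge0// mulr_ge0.
have i1 := integrable_itv_affine c0 (2 * b1) s0 (int0 _ (cxi j) s s0).
have i2 := integrable_itv_affine 0 (2 * b2) s0 (int0 _ cX s s0).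
have i3 := integrable_itv_affine 0 k s0 (int0 _ cE s s0).
have i12 : mu.-integrable `[0, s] (EFin \o (fun r =>
    (c0 + 2 * b1 * `|x j r w - x j 0 w|) + (0 + 2 * b2 * `|X r|))).
  by have := integrableD (measurable_itv0 s) i1 i2; apply: eq_integrable.
have ig : mu.-integrable `[0, s] (EFin \o g).
  by have := integrableD (measurable_itv0 s) i12 i3; apply: eq_integrable.
have gE : \int[mu]_(r in `[0, s]) g r <=
    2 * b1 * Q j + 2 * b2 * Z + 2 * b2 * (T * L) + k * (expR (l * s) / l).
  rewrite /g RintegralD// RintegralD// !Rintegral_itv_affine//; try exact: int0.
  rewrite mulr0 !add0r; apply: lerD; last first.
    by rewrite ler_wpM2l// integral_expR_le.
  have h1 : 2 * b1 * \int[mu]_(r in `[0, s]) `|x j r w - x j 0 w| <= 2 * b1 * Q j.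
    rewrite ler_wpM2l ?mulr_ge0//; apply: le_trans (HQ j).
    by apply: Rintegral_itv_le => //; exact: int0.
  have h2 : 2 * b2 * \int[mu]_(r in `[0, s]) `|X r| <= 2 * b2 * Z.
    rewrite ler_wpM2l ?mulr_ge0//; apply: le_trans HZ.
    by apply: Rintegral_itv_le => //; exact: int0.
  have h3 : s * c0 <= 2 * b2 * (T * L).
    rewrite (_ : 2 * b2 * (T * L) = T * c0); last by rewrite /c0; ring.
    by rewrite ler_wpM2r// !mulr_ge0.
  lra.
have pointwise r : 0 <= r <= s -> 2 * `|tau j r - taul j r| + 2 * u j r <= g r.
  move=> /andP[r0 rs]; have rT : 0 <= r <= T by rewrite r0 (le_trans rs).
  have hu := uS j r rT; have hL := HL rT.
  (* The average of the limit spins at the sampled x_i(0) is inserted: its distance to M is an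
     average of spin errors, its distance to the limit mean is at most [L]. *)
  have hM : `|M r - limit_mean ss ml r| <= average S * expR (l * r) + L.
    rewrite -[M r](subrK (average (fun i' => ml r (x i' 0 w)))) -addrA.
    apply: le_trans (ler_normD _ _) _; apply: lerD => //.
    rewrite -averageB; apply: le_trans (ler_norm_average _) _.
    rewrite mulrC -averageZ; apply: le_average => i'.
    by rewrite mulrC; exact: uS.
  have ht : `|tau j r - taul j r| <= b1 * `|x j r w - x j 0 w| + b1 * u j r
      + b2 * `|X r| + b2 * `|M r - limit_mean ss ml r|.
    apply: le_trans (tanh_lipschitz _ _) _.
    rewrite (_ : _ - _ = b1 * (x j r w - x j 0 w) + b1 * (m j r w - ml r (x j 0 w))
      + b2 * X r + b2 * (M r - limit_mean ss ml r)); last by ring.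
    do 3 (apply: le_trans (ler_normD _ _) _; apply: lerD;
      last by rewrite normrM ger0_norm).
    by rewrite normrM ger0_norm.
  have h1 : b1 * u j r <= b1 * (S j * expR (l * r)) by rewrite ler_wpM2l.
  have h2 := ler_wpM2l b2_ge0 hM.
  rewrite /g /c0 /k; move: ht h1 h2 hu; lra.
apply: le_trans (spin_difference sT ig pointwise) _.
by rewrite /G -/k -!addrA lerD2l lerD2l; move: gE; rewrite -!addrA.
Qed.

End spin_path.

(** * Mean of the pathwise bound *)

Section source_independence.
Context {R : realType} d {Omega : measurableType d} (P : probability Omega R).

Lemma independent_pair (I : finType) (F : I -> set (set Omega)) (i j : I) A B :
  independent P F -> i != j -> F i A -> F j B ->
  P (A `&` B) = (P A * P B)%E.
Proof.
move=> indF ij FA FB.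
have := indF [set i; j]%SET (fun k => if k == i then A else B).
rewrite big_setU1 ?inE//= big_set1 eqxx [j == i]eq_sym (negbTE ij) => <-.
  congr (P _); apply/seteqP; split => [w [Aw Bw] k|w capw].
    by rewrite /= !inE => /orP[/eqP->|/eqP->]; rewrite ?eqxx// eq_sym (negbTE ij).
  split.
    by have := capw i; rewrite eqxx; apply; rewrite /= !inE eqxx.
  by have := capw j; rewrite eq_sym (negbTE ij); apply; rewrite /= !inE eqxx orbT.
by move=> k; rewrite !inE => /orP[/eqP->|/eqP->]; rewrite ?eqxx// eq_sym (negbTE ij).
Qed.

Lemma sigma_rv_preimage (X : Omega -> R) (B : set R) :
  measurable B -> sigma_rv X (X @^-1` B).
Proof. by move=> mB; exists B => //; rewrite setTI. Qed.

Lemma bounded_mean_sqr (X : Omega -> R) (c : R) : measurable_fun setT X ->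
  (forall w, `|X w| <= c) -> mean_le P (fun w => X w ^+ 2) (c ^+ 2).
Proof.
move=> mX Xc; apply: (mean_le_dom (g := cst (c ^+ 2))).
- exact: measurable_funX.
- move=> w; rewrite sqr_ge0/= -real_normK ?num_real// lerXn2r ?nnegrE//.
  exact: le_trans (Xc w).
- by apply: mean_le_cst; exact: sqr_ge0.
Qed.

End source_independence.

Local Ltac nonneg := repeat first [assumption | exact: ltW | exact: ler01
  | exact: ler0n | exact: sqr_ge0 | apply: addr_ge0 | apply: mulr_ge0].

Section process_means.
Context {R : realType} d {Omega : measurableType d} (P : probability Omega R).
Context (n : nat) (T alpha2 sigma beta1 beta2 p sstar kappa : R).
Context (mu : 'I_n.+1 -> 'I_n.+1 -> Omega -> R) (W : 'I_n.+1 -> R -> Omega -> R).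
Context (Y : bool -> 'I_n.+1 -> R -> Omega -> R) (x m : 'I_n.+1 -> R -> Omega -> R).
Context (ml : R -> R -> R).
Hypothesis HP : two_level_process P alpha2 sigma beta1 beta2 p sstar mu W Y x m.
Hypothesis Hml : limit_solution beta1 beta2 p sstar ml.
Hypotheses (T0 : 0 < T) (alpha2_ge0 : 0 <= alpha2) (sigma_ge0 : 0 <= sigma).
Hypotheses (s0 : 0 < sstar) (s_kappa : sstar <= kappa).
Local Notation lambda := (@lebesgue_measure R).

Definition root_inv : R := (Num.sqrt n.+1%:R)^-1.
Local Notation r := root_inv.

Let r_gt0 : 0 < r. Proof. by rewrite invr_gt0 sqrtr_gt0. Qed.

Let r_sqr : r * r = n.+1%:R^-1.
Proof. by rewrite -invfM -expr2 sqr_sqrtr. Qed.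

Let r_le1 : r <= 1.
Proof. by rewrite invf_le1 ?sqrtr_gt0// -[leLHS]sqrtr1 ler_sqrt// ler1n. Qed.

Let mx0 i : measurable_fun setT (x i 0). Proof. exact: (x_measurable HP). Qed.

(** [c1] bounds the mean of |x_i(0)| and [c2] that of the integral of |W_i| over [0, T]. Both come
    from Young's inequality with e = 1 and the Gaussian bound 6 s^2, where s^2 is at most kappa^2,
    respectively T. *)
Let c1 := (1 + 6 * kappa ^+ 2) / 2.
Let c2 := T * ((1 + 6 * T) / 2).

Let sqr_x0 i : mean_le P (fun w => x i 0 w ^+ 2) (6 * kappa ^+ 2).
Proof.
apply: mean_leW (normal_mean_sqr s0 (mx0 i) (x0_law HP i)).
by rewrite ler_wpM2l// lerXn2r// ?nnegrE ltW// (lt_le_trans s0).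
Qed.

Let mean_x0 i : mean_le P (fun w => `|x i 0 w|) c1.
Proof. by have := mean_le_sqr ltr01 (mx0 i) (sqr_x0 i); rewrite divr1. Qed.

Let pair_x0 i j : i != j -> pair_independent P (x i 0) (x j 0).
Proof.
move=> ij A B mA mB.
apply: (@independent_pair _ _ _ _ _ _ (inl (inl i)) (inl (inl j))
  _ _ (sources_independent HP)) => //; exact: sigma_rv_preimage.
Qed.

(* With [e = r] in Young's inequality, an average of [n.+1] uncorrelated centered
   variables has mean absolute value of order [r]. *)
Let mean_average (Z : 'I_n.+1 -> Omega -> R) v :
  (forall i, measurable_fun setT (Z i)) ->
  (forall i, (\int[P]_w (Z i w)%:E = 0)%E) ->
  (forall i, mean_le P (fun w => Z i w ^+ 2) v) ->
  (forall i j, i != j -> pair_independent P (Z i) (Z j)) ->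
  mean_le P (fun w => `|average (Z ^~ w)|) ((1 + v) / 2 * r).
Proof.
move=> mZ EZ vZ indZ.
have mA : measurable_fun setT (fun w => average (Z ^~ w)).
  by apply: measurable_funM => //; exact: measurable_sum.
have := mean_le_sqr r_gt0 mA (mean_le_average_sqr mZ EZ vZ indZ).
apply: mean_leW; rewrite -r_sqr le_eqVlt; apply/orP; left; apply/eqP; field.
by rewrite gt_eqF.
Qed.

Let mean_X0 : mean_le P (fun w => `|average (fun i => x i 0 w)|) (c1 * r).
Proof.
apply: mean_average => // i; exact: (normal_mean s0 (mx0 i) (x0_law HP i)).
Qed.

(** Each mu is 2 times an indicator minus 1, so it has mean 2 p - 1. The centred variable is at most
    2 in absolute value, whence 5/2 = (1 + 2^2) / 2. *)
Let mean_m0 i : mean_le P (fun w => `|m i 0 w - (2 * p - 1)|) (5 / 2 * r).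
Proof.
have mm k : measurable_fun setT (mu k i) by exact: (mu_measurable HP).
have -> : (fun w => `|m i 0 w - (2 * p - 1)|) =
    (fun w => `|average (fun k => mu k i w - (2 * p - 1))|).
  by apply/funext => w; rewrite averageB average_cst (m0 HP).
have muE k w : mu k i w = 2 * \1_[set w | mu k i w = 1] w - 1.
  rewrite indicE; case: (mu_values HP k i w) => e; last first.
    by rewrite mem_set ?e//=; ring.
  rewrite memNset ?e/=; first by ring.
  by rewrite e; lra.
have m1 k : measurable [set w | mu k i w = 1].
  by rewrite -[X in measurable X]setTI; exact: (mm k measurableT [set 1]).
have p01 : 0 <= p <= 1.
  have e := mu_law HP i i; rewrite -!lee_fin -e measure_ge0 /=.
  exact: probability_le1.
have mZ k : measurable_fun setT (fun w => mu k i w - (2 * p - 1)).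
  exact: measurable_funB.
have {1}-> : 5 / 2 = (1 + 2 ^+ 2) / 2 :> R by congr (_ / _); ring.
apply: mean_average => //.
- move=> k; have -> : (\int[P]_w (mu k i w - (2 * p - 1))%:E =
      \int[P]_w ((2 * \1_[set w | mu k i w = 1] w)%:E - (2 * p)%:E))%E.
    by apply: eq_integral => w _; rewrite muE -EFinB; congr EFin; ring.
  have i1 : P.-integrable setT (fun w => (2 * \1_[set w | mu k i w = 1] w)%:E).
    under eq_fun do rewrite EFinM.
    by apply: integrableZl => //; exact: integrable_indic.
  rewrite integralB_EFin//; last exact: finite_measure_integrable_cst.
  under eq_integral do rewrite EFinM.
  rewrite ge0_integralZl_EFin//; last exact/measurable_EFinP/measurable_indic.
  rewrite integral_indic// setIT [X in (_ * X - _)%E](mu_law HP k i).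
  rewrite integral_cst//= probability_setT mule1.
  by rewrite -EFinM -EFinB subrr.
- move=> k; apply: bounded_mean_sqr => // w; rewrite ler_norml.
  by case: (mu_values HP k i w) => ->; apply/andP; split; lra.
- move=> k k' kk'.
  have mB : measurable_fun setT (fun z : R => z - (2 * p - 1)).
    exact: measurable_funB.
  apply: (@pair_independent_comp _ _ _ _ (mu k i) (mu k' i) _ _ mB mB) => A B mA mB'.
  apply: (@independent_pair _ _ _ _ _ _ (inl (inr (k, i))) (inl (inr (k', i)))
    _ _ (sources_independent HP)); try exact: sigma_rv_preimage.
  by apply: contra kk' => /eqP[->].
Qed.

(** The x_i(0) have exactly the law that defines the limit mean for the same N, so the variables are
    centred even when that law varies with N. They are bounded by 2, whence 5/2 again. *)
Let mean_limit s : 0 <= s ->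
  mean_le P (fun w => `|average (fun i => ml s (x i 0 w)) - limit_mean sstar ml s|)
    (5 / 2 * r).
Proof.
move=> s_ge0; have mm := limit_space_measurable Hml s_ge0.
have -> : (fun w => `|average (fun i => ml s (x i 0 w)) - limit_mean sstar ml s|) =
    (fun w => `|average (fun i => ml s (x i 0 w) - limit_mean sstar ml s)|).
  by apply/funext => w; rewrite averageB average_cst.
have mZ i : measurable_fun setT (fun w => ml s (x i 0 w)) by exact: measurableT_comp.
have iZ i : P.-integrable setT (EFin \o (fun w => ml s (x i 0 w))).
  apply: measurable_bounded_integrable => //.
    by rewrite -ge0_fin_numE// fin_num_measure.
  exists 1; split=> // c c_gt1 w _ /=.
  exact: le_trans (limit_norm Hml _ s_ge0) (ltW c_gt1).
have EZ i : (\int[P]_w (ml s (x i 0 w))%:E = (limit_mean sstar ml s)%:E)%E.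
  rewrite (integral_law (nu := normal_prob 0 sstar) (mx0 i) (x0_law HP i)
    (f := EFin \o ml s)); [|exact/measurable_EFinP|exact: iZ].
  rewrite /limit_mean /Rintegral fineK//.
  exact: (integrable_fin_num measurableT (limit_integrable Hml s_ge0)).
have M1 : `|limit_mean sstar ml s| <= 1.
  have i0 : 'I_n.+1 := ord0.
  rewrite -lee_fin -abse_EFin -(EZ i0).
  apply: le_trans (le_abse_integral _ _ _) _ => //.
    exact/measurable_EFinP.
  have : mean_le P (fun w => `|ml s (x i0 0 w)|) 1.
    apply: (mean_le_dom (g := cst 1)); last exact: mean_le_cst.
      exact: measurableT_comp.
    by move=> w; rewrite normr_ge0 (limit_norm Hml).
  by case.
have {1}-> : 5 / 2 = (1 + 2 ^+ 2) / 2 :> R by congr (_ / _); ring.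
apply: mean_average.
- by move=> i; exact: measurable_funB.
- move=> i; under eq_integral do rewrite EFinB.
  rewrite integralB_EFin//; last exact: finite_measure_integrable_cst.
  by rewrite EZ integral_cst//= probability_setT mule1 -EFinB subrr.
- move=> i; apply: bounded_mean_sqr; first exact: measurable_funB.
  move=> w; apply: le_trans (ler_normB _ _) _.
  by have := limit_norm Hml (x i 0 w) s_ge0; lra.
- move=> i j ij.
  have mB : measurable_fun setT (fun z : R => ml s z - limit_mean sstar ml s).
    exact: measurable_funB.
  exact: (pair_independent_comp mB mB (pair_x0 ij)).
Qed.

Let mean_W i t : 0 <= t <= T -> mean_le P (fun w => `|W i t w|) ((1 + 6 * T) / 2).
Proof.
have HW := W_brownian HP i; move=> /andP[+ tT].
rewrite le_eqVlt => /predU1P[<-|t0].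
  rewrite (_ : (fun _ => _) = cst 0); last first.
    by apply/funext => w; rewrite (brownian0 HW) normr0.
  apply: mean_leW (mean_le_cst _ _) => //.
  by rewrite mulr_ge0// addr_ge0// mulr_ge0// ltW.
have mW := brownian_measurable HW (ltW t0).
have st : 0 < Num.sqrt t by rewrite sqrtr_gt0.
have law B : measurable B -> P (W i t @^-1` B) = normal_prob 0 (Num.sqrt t) B.
  move=> mB; have := brownian_normal HW (lexx 0) t0 mB; rewrite subr0 => <-.
  by congr (P _); apply/seteqP; split => w /=; rewrite (brownian0 HW) subr0.
have := mean_le_sqr ltr01 mW (normal_mean_sqr st mW law); rewrite divr1.
by apply: mean_leW; rewrite sqr_sqrtr ?(ltW t0)//; lra.
Qed.

Let B i w := \int[lambda]_(t in `[0, T]) `|W i t w|.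

Let mean_B i : mean_le P (B i) c2.
Proof.
have HW := W_brownian HP i.
apply: mean_le_Rintegral; [| |exact: ltW| |exact: mean_W].
- by move=> t t0; exact: (brownian_measurable HW).
- move=> t w t0; apply: within_itvcy_right => //; exact: (brownian_continuous HW).
- by rewrite mulr_ge0// addr_ge0// mulr_ge0// ltW.
Qed.

Section grid.
Variable K : nat.
(** Mesh of the clock range [0, 2NT]; after the factor 2/N it contributes order 1/K. *)
Let h := 2 * n.+1%:R * T / K.+1%:R.

Let D up i w := \sum_(k < K.+3) `|Y up i (k%:R * h) w - k%:R * h| + h.

Let h_gt0 : 0 < h. Proof. by rewrite divr_gt0// !mulr_gt0. Qed.

Let root_invV : (n.+1%:R * r)^-1 = r.
Proof. by rewrite invfM -r_sqr mulfK// gt_eqF. Qed.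

(** Young's inequality with e = N r = sqrt N balances e against variance / e: every grid time is at
    most 4 T N, as the next step shows. *)
Let mean_D up i : mean_le P (D up i)
  (K.+3%:R * ((1 + 4 * T) / 2 * (n.+1%:R * r)) + h).
Proof.
have HY := Y_poisson HP up i.
apply: mean_leD; last by apply: mean_le_cst; exact: ltW.
rewrite (_ : K.+3%:R * _ =
  \sum_(k < K.+3) ((1 + 4 * T) / 2 * (n.+1%:R * r))); last first.
  by rewrite sumr_const card_ord mulr_natl.
apply: mean_le_sum => k; set u := k%:R * h.
have : 0 <= u by rewrite mulr_ge0// ltW.
rewrite le_eqVlt => /predU1P[<-|u0].
  rewrite (_ : (fun _ => _) = cst 0); last first.
    by apply/funext => w; rewrite (poisson0 HY) subrr normr0.
  apply: mean_leW (mean_le_cst _ _) => //.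
  by rewrite !mulr_ge0// ?addr_ge0// ?mulr_ge0// ltW.
have mY := poisson_measurable HY (ltW u0).
have mf : measurable_fun setT (fun w => Y up i u w - u) by exact: measurable_funB.
have e0 : 0 < n.+1%:R * r by rewrite mulr_gt0.
apply: mean_leW (mean_le_sqr e0 mf (poisson_mean_sqr HY u0)).
rewrite root_invV [leRHS]mulrAC ler_wpM2r// mulrDl mul1r lerD2l.
rewrite mulrA ler_wpM2r ?(ltW r_gt0)//.
have -> : 4 * T * n.+1%:R = 2 * K.+1%:R * h.
  by rewrite /h; field; rewrite addrC natr1.
rewrite ler_wpM2r ?(ltW h_gt0)// -natrM ler_nat.
(* The last grid point, index [K.+2], overshoots the range but is still at most twice its length: K
   + 2 <= 2 (K + 1). *)
apply: leq_trans (_ : K.+2 <= _)%N; first by rewrite -ltnS.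
by rewrite mul2n -addnn addSnnS leq_addl.
Qed.

(** The 8 is a Lipschitz constant in time: 4 for the average of the limit spins and 4 for the limit
    mean. *)
Let L w := \sum_(k < K.+2) `|average (fun i => ml (k%:R * (T / K.+1%:R)) (x i 0 w))
    - limit_mean sstar ml (k%:R * (T / K.+1%:R))| + 8 * (T / K.+1%:R).

Let mean_L : mean_le P L (K.+2%:R * (5 / 2 * r) + 8 * (T / K.+1%:R)).
Proof.
apply: mean_leD; last by apply: mean_le_cst; rewrite mulr_ge0// divr_ge0// ltW.
rewrite (_ : K.+2%:R * _ = \sum_(k < K.+2) (5 / 2 * r)); last first.
  by rewrite sumr_const card_ord mulr_natl.
apply: mean_le_sum => k; apply: mean_limit.
by rewrite mulr_ge0// divr_ge0// ltW.
Qed.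

Let X0 w := `|average (fun i => x i 0 w)|.
Let a := alpha2 / n.+1%:R.
Let s := sigma / Num.sqrt n.+1%:R.
Let Q i w := a * T * (2 * (T * `|x i 0 w| + T * X0 w
  + s * (B i w + average (B ^~ w)))) + s * B i w.
Let Z w := T * X0 w + s * average (B ^~ w).
(** [Q] with its order r taken out: the first term gets it from a <= alpha2 r, the last from s =
    sigma r, and the remaining factors are bounded through s <= sigma and r <= 1. *)
Let q := alpha2 * T * (2 * (T * c1 + T * c1 + sigma * (c2 + c2))) + sigma * c2.
Let z := T * c1 + sigma * c2.

Let a_ge0 : 0 <= a. Proof. by rewrite divr_ge0. Qed.
Let s_ge0 : 0 <= s. Proof. by rewrite divr_ge0// sqrtr_ge0. Qed.
Let a_le : a <= alpha2 * r.
Proof. by rewrite /a -r_sqr ler_wpM2l// ler_piMr// ltW. Qed.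
Let s_le : s <= sigma.
Proof. by rewrite /s ler_piMr. Qed.
Let c1_ge0 : 0 <= c1. Proof. by rewrite mulr_ge0// addr_ge0// mulr_ge0// sqr_ge0. Qed.
Let c2_ge0 : 0 <= c2.
Proof. by rewrite mulr_ge0 ?(ltW T0)// mulr_ge0// addr_ge0// mulr_ge0// ltW. Qed.

Let mean_Q i : mean_le P (Q i) (q * r).
Proof.
have T_ge0 := ltW T0; have r_ge0 := ltW r_gt0.
have := mean_leD
  (mean_leZ (mulr_ge0 a_ge0 T_ge0) (mean_leZ (ler0n _ 2)
    (mean_leD (mean_leD (mean_leZ T_ge0 (mean_x0 i)) (mean_leZ T_ge0 mean_X0))
      (mean_leZ s_ge0 (mean_leD (mean_B i) (mean_le_average mean_B))))))
  (mean_leZ s_ge0 (mean_B i)).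
apply: mean_leW; rewrite /q [leRHS]mulrDl; apply: lerD; last first.
  by rewrite /s -/r mulrAC.
rewrite [leRHS]mulrAC; apply: ler_pM.
- by rewrite mulr_ge0.
- by nonneg.
- by rewrite [leRHS]mulrAC ler_wpM2r.
- rewrite ler_wpM2l//; apply: lerD; last by rewrite ler_wpM2r// addr_ge0.
  by rewrite lerD2l ler_wpM2l// ler_piMr.
Qed.

Let mean_Z : mean_le P Z (z * r).
Proof.
have T_ge0 := ltW T0.
have := mean_leD (mean_leZ T_ge0 mean_X0) (mean_leZ s_ge0 (mean_le_average mean_B)).
by apply: mean_leW; rewrite /z mulrDl mulrA lerD2l /s -/r mulrAC.
Qed.

Let G i w := `|m i 0 w - (2 * p - 1)| + 2 / n.+1%:R * (D true i w + D false i w)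
  + 2 * beta1 * Q i w + 2 * beta2 * Z w + 2 * beta2 * (T * L w).

Hypotheses (beta1_ge0 : 0 <= beta1) (beta2_ge0 : 0 <= beta2).

(** The sum of the coefficients of (K + 3) r and of 1 / (K + 1), so that one constant serves both.
    The last two terms come from the meshes of the clock and time grids. *)
Definition error_constant : R := 5 / 2 + 2 * (1 + 4 * T) + 2 * beta1 * q
  + 2 * beta2 * z + 5 * beta2 * T + 8 * T + 16 * beta2 * T ^+ 2.

Let mean_G i : mean_le P (G i) (error_constant * (K.+3%:R * r + K.+1%:R^-1)).
Proof.
have T_ge0 := ltW T0; have r_ge0 := ltW r_gt0.
have N_ge0 : 0 <= 2 / n.+1%:R :> R by rewrite divr_ge0.
have := mean_leD (mean_leD (mean_leD (mean_leD (mean_m0 i)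
  (mean_leZ N_ge0 (mean_leD (mean_D true i) (mean_D false i))))
  (mean_leZ (mulr_ge0 (ler0n _ 2) beta1_ge0) (mean_Q i)))
  (mean_leZ (mulr_ge0 (ler0n _ 2) beta2_ge0) mean_Z))
  (mean_leZ (mulr_ge0 (ler0n _ 2) beta2_ge0) (mean_leZ T_ge0 mean_L)).
apply: mean_leW; set e := K.+1%:R^-1; set k := K.+3%:R; set k' := K.+2%:R.
have e0 : 0 <= e by rewrite invr_ge0.
have k1 : r <= k * r by rewrite ler_peMl// ler1n.
have k2 : k' * r <= k * r by rewrite ler_wpM2r// ler_nat.
have hE : 2 / n.+1%:R * h = 4 * T * e.
  by rewrite /h /e; field; rewrite addrC natr1 addrC natr1 !pnatr_eq0.
have NV : n.+1%:R^-1 * n.+1%:R = 1 :> R by rewrite mulVf.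
have k0 : 0 <= k by exact: ler0n.
move: hE; clearbody e k k' => hE.
have q0 : 0 <= q by nonneg.
have z0 : 0 <= z by nonneg.
have -> : 2 / n.+1%:R * (k * ((1 + 4 * T) / 2 * (n.+1%:R * r)) + h
    + (k * ((1 + 4 * T) / 2 * (n.+1%:R * r)) + h)) =
    2 * (1 + 4 * T) * (k * r) + 8 * T * e.
  transitivity (2 * (1 + 4 * T) * (n.+1%:R^-1 * n.+1%:R) * (k * r)
    + 2 * (2 / n.+1%:R * h)); last by rewrite NV hE; ring.
  have cE : 1 + 4 * T = 2 * ((1 + 4 * T) / 2) by field.
  by rewrite [in RHS]cE; move: (_ / 2) => c; ring.
have -> : 2 * beta2 * (T * (k' * (5 / 2 * r) + 8 * (T * e))) =
    5 * beta2 * T * (k' * r) + 16 * beta2 * T ^+ 2 * e by field.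
have h1 : 2 * beta1 * (q * r) <= 2 * beta1 * q * (k * r).
  by rewrite mulrA ler_wpM2l ?mulr_ge0.
have h2 : 2 * beta2 * (z * r) <= 2 * beta2 * z * (k * r).
  by rewrite mulrA ler_wpM2l ?mulr_ge0.
have h3 : 5 * beta2 * T * (k' * r) <= 5 * beta2 * T * (k * r).
  by rewrite ler_wpM2l ?mulr_ge0.
have kr0 : 0 <= k * r by rewrite mulr_ge0.
have h4 : 0 <= 8 * T * (k * r) by rewrite !mulr_ge0.
have h5 : 0 <= 16 * beta2 * T ^+ 2 * (k * r) by rewrite !mulr_ge0.
have h6 : 0 <= (5 / 2 + 2 * (1 + 4 * T) + 2 * beta1 * q + 2 * beta2 * z
    + 5 * beta2 * T) * e.
  by nonneg.
have -> : error_constant * (k * r + e) =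
    5 / 2 * (k * r) + 2 * (1 + 4 * T) * (k * r) + 2 * beta1 * q * (k * r)
    + 2 * beta2 * z * (k * r) + 5 * beta2 * T * (k * r) + 8 * T * (k * r)
    + 16 * beta2 * T ^+ 2 * (k * r) + 8 * T * e + 16 * beta2 * T ^+ 2 * e
    + (5 / 2 + 2 * (1 + 4 * T) + 2 * beta1 * q + 2 * beta2 * z
    + 5 * beta2 * T) * e.
  by rewrite /error_constant; ring.
lra.
Qed.

(** The factor 4 is the 2 of the contraction times the two terms [G i] and [average G], which obey
    the same mean bound. The condition on alpha2 T / N is the absorption condition for the
    diffusions. *)
Lemma mean_sup_error_le i : alpha2 / n.+1%:R * T <= 1 / 2 ->
  (\int[P]_w (sup [set `|m i t w - ml t (x i 0 w)| | t in `[0, T]])%:E <=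
  (4 * expR (4 * (beta1 + 1 + beta2) * T) *
    (error_constant * (K.+3%:R * r + K.+1%:R^-1)))%:E)%E.
Proof.
move=> aT; set E := expR _.
have T_ge0 := ltW T0.
have E2 : 0 <= 2 * E by rewrite mulr_ge0// expR_ge0.
apply: (integral_le_mean (g := fun w => 2 * E * (G i w + average (G ^~ w)))).
- apply: mean_leW (mean_leZ E2 (mean_leD (mean_G i) (mean_le_average mean_G))).
  rewrite le_eqVlt; apply/orP; left; apply/eqP; ring.
- by move=> w; exact: sup_norm_ge0.
(* The indices are finitely many, so all the equations hold together outside a single null set. *)
have FP : Filter (almost_everywhere P) by exact: ae_filter_ringOfSetsType.
have aem := filter_forall FP (m_equation HP).
have aex := filter_forall FP (x_equation HP).
apply: (filterS2 FP _ aex aem) => w ex em; apply: ge_sup.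
  by exists `|m i 0 w - ml 0 (x i 0 w)|, 0 => //; rewrite /= in_itv/= lexx.
move=> _ [t tT <-]; move: tT; rewrite /= in_itv/= => tT.
have cx k : {within `[0, +oo[, continuous (x k ^~ w)} by exact: (x_continuous HP).
have cW k : {within `[0, +oo[, continuous (W k ^~ w)}.
  exact: (brownian_continuous (W_brownian HP k)).
have N0 : 0 < 2 * n.+1%:R * T by rewrite !mulr_gt0.
apply: (@spin_path _ _ _ w n beta1 beta2 p sstar T x m (fun up k u => Y up k u w) ml
  (fun up k => D up k w) (fun k => Q k w) (Z w) (L w)) => //.
- by move=> k u u0; have [] := m_cadlag HP k w u0.
- move=> k u u0; have [c cN ->] := m_values HP k w u0.
  have c_ge0 : 0 <= 2 * c%:R / n.+1%:R :> R by rewrite divr_ge0 ?mulr_ge0.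
  have c_le2 : 2 * c%:R / n.+1%:R <= 2 :> R.
    by rewrite ler_pdivrMr// ler_wpM2l// ler_nat.
  move: (2 * c%:R / n.+1%:R) c_ge0 c_le2 => v *.
  by rewrite ler_norml; apply/andP; split; lra.
- move=> up k u uU; apply: (@nondecreasing_grid _ (fun v => Y up k v w) _ K N0 _ _ uU).
  by move=> u1 u2 u10 u12; exact: (poisson_nondecreasing (Y_poisson HP up k)).
- move=> k; exact: (@diffusion_displacement _ _
    (fun k u => x k u w) (fun k u => W k u w) a s T).
- exact: (@diffusion_average_integral _ _
    (fun k u => x k u w) (fun k u => W k u w) a s T).
- move=> u uT; apply: (@lipschitz_grid _ (fun u =>
    average (fun k => ml u (x k 0 w)) - limit_mean sstar ml u) T 8 K) => //.
  move=> u1 u2 u10 u20.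
  rewrite (_ : _ - _ - _ = average (fun k => ml u1 (x k 0 w) - ml u2 (x k 0 w))
    - (limit_mean sstar ml u1 - limit_mean sstar ml u2)); last first.
    by rewrite averageB; ring.
  apply: le_trans (ler_normB _ _) _; rewrite (_ : 8 = 4 + 4); last by ring.
  rewrite mulrDl; apply: lerD; last exact: (limit_mean_lipschitz Hml).
  apply: le_trans (ler_norm_average _) _.
  rewrite -[leRHS](average_cst n); apply: le_average => k.
  exact: (limit_lipschitz Hml).
Qed.

End grid.

End process_means.

(** * The limit *)

Lemma cvg0_le_ereal {R : realType} (E : nat -> \bar R) :
  (forall n, (0 <= E n)%E) ->
  (forall e : R, 0 < e -> \forall n \near \oo, (E n <= e%:E)%E) ->
  E n @[n --> \oo] --> 0%E.
Proof.
move=> E0 Ee; apply/fine_cvgP; split.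
  apply: filterS (Ee 1 ltr01) => n En.
  by rewrite ge0_fin_numE// (le_lt_trans En)// ltry.
apply/cvgrPdist_le => e e0; apply: filterS (Ee e e0) => n En /=.
rewrite sub0r normrN ger0_norm; last exact: fine_ge0.
by rewrite -lee_fin fineK// ge0_fin_numE// (le_lt_trans En)// ltry.
Qed.

(** K + 1 >= 2 C / e makes the mesh term at most e / 2. With K fixed, sqrt (n + 1) >= 2 C (K + 3) /
    e does the same for the fluctuation term. *)
Lemma grid_error_small {R : realType} (C e : R) : 0 <= C -> 0 < e ->
  exists K : nat, \forall n \near \oo,
    C * (K.+3%:R * root_inv n + K.+1%:R^-1) <= e.
Proof.
move=> C0 e0; pose K := Num.trunc (2 * C / e); exists K.
pose M := 2 * C * K.+3%:R / e.
near=> n.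
have M0 : 0 <= M by rewrite divr_ge0 ?(ltW e0)// !mulr_ge0.
have sM : M <= Num.sqrt n.+1%:R.
  rewrite -(ger0_norm M0) -sqrtr_sqr ler_sqrt//.
  by rewrite -natr1 (@le_trans _ _ n%:R) ?lerDl//; near: n; exact: nbhs_infty_ger.
have h1 : C * (K.+3%:R * root_inv n) <= e / 2.
  rewrite /root_inv mulrA ler_pdivrMr ?sqrtr_gt0//.
  have := ler_wpM2l (ltW e0) sM; rewrite /M mulrCA mulfV ?gt_eqF// mulr1; lra.
have h2 : C * K.+1%:R^-1 <= e / 2.
  rewrite ler_pdivrMr//.
  have : 2 * C / e <= K.+1%:R by apply: ltW; exact: truncnS_gt.
  by rewrite ler_pdivrMr//; lra.
by rewrite mulrDr [leRHS]splitr lerD.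
Unshelve. all: by end_near. Qed.

(* The index n stands for N = n.+1. *)
Theorem theorem4p1 (R : realType) (T : R) (hT : 0 < T)
    (beta1 beta2 alpha1 alpha2 sigma : R)
    (hbeta1 : 0 < beta1) (hbeta2 : 0 < beta2)
    (halpha1 : 0 < alpha1) (halpha2 : 0 < alpha2) (hsigma : 0 < sigma)
    (p : R) (hp : 0 <= p <= 1)
    (sstar : nat -> R)
    (hsstar : (exists2 s : R, 0 < s & forall n, sstar n = s) \/
              (forall n, sstar n = 1 / Num.sqrt n.+1%:R))
    (d : nat -> measure_display) (Omega : forall n, measurableType (d n))
    (P : forall n, probability (Omega n) R)
    (mu : forall n, 'I_n.+1 -> 'I_n.+1 -> Omega n -> R)
    (W : forall n, 'I_n.+1 -> R -> Omega n -> R)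
    (Y : forall n, bool -> 'I_n.+1 -> R -> Omega n -> R)
    (x m : forall n, 'I_n.+1 -> R -> Omega n -> R)
    (hxm : forall n, two_level_process (P n) alpha2 sigma beta1 beta2 p
                       (sstar n) (mu n) (W n) (Y n) (x n) (m n))
    (mlim : nat -> R -> R -> R)
    (hmlim : forall n, limit_solution beta1 beta2 p (sstar n) (mlim n))
    (j : forall n, 'I_n.+1) :
  ('E_(P n)[(fun w => sup [set `|m n (j n) t w - mlim n t (x n (j n) 0 w)|
                          | t in `[0, T]])%R])%E @[n --> \oo] --> 0%E.
Proof.
(* Both choices of the initial deviation are bounded in N, by the constant itself or by 1, and are
   treated together from here on. *)
have [kappa sk] : exists kappa, forall n, 0 < sstar n <= kappa.
  case: hsstar => [[s s0 sE]|sE]; first by exists s => n; rewrite sE s0 lexx.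
  exists 1 => n; rewrite sE div1r invr_gt0 sqrtr_gt0 ltr0n/=.
  by rewrite invf_le1 ?sqrtr_gt0// -[leLHS]sqrtr1 ler_sqrt// ler1n.
apply: cvg0_le_ereal => [n|e e0].
  by apply: expectation_ge0 => w; exact/sup_norm_ge0/ltW.
(* The absolute value gives C >= 0 without examining the sign of the constant. *)
pose C := 4 * expR (4 * (beta1 + 1 + beta2) * T) *
  `|error_constant T alpha2 sigma beta1 beta2 kappa|.
have C0 : 0 <= C by rewrite !mulr_ge0 ?expR_ge0.
have [K small] := grid_error_small C0 e0.
near=> n.
have aT : alpha2 / n.+1%:R * T <= 1 / 2.
  rewrite mulrAC ler_pdivrMr//.
  have : 2 * (alpha2 * T) <= n%:R by near: n; exact: nbhs_infty_ger.
  by rewrite -[n.+1%:R]natr1; move: (n%:R) => N; lra.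
have [s0 sn] := andP (sk n).
have := mean_sup_error_le (hxm n) (hmlim n) hT (ltW halpha2) (ltW hsigma)
  s0 sn K (ltW hbeta1) (ltW hbeta2) (j n) aT.
rewrite unlock => /le_trans; apply.
rewrite lee_fin; apply: le_trans (_ : C * (K.+3%:R * root_inv n + K.+1%:R^-1) <= _).
  rewrite /C -!mulrA !ler_wpM2l ?expR_ge0// ler_wpM2r ?ler_norm//.
  by rewrite addr_ge0// mulr_ge0// invr_ge0 sqrtr_ge0.
by near: n.
Unshelve. all: by end_near. Qed.
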